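(* Let $\Omega\subseteq\mathbb{R}^n$ be open and bounded, let $1\le p<\infty$, and let $\mathcal{C}=\{\mathbf V_1,\ldots,\mathbf V_m\}$ be a collection of Lipschitz vector fields $\mathbf V_1,\dots,\mathbf V_m\in\mathrm{Lip}(\Omega)^n$. Suppose there exists $j\in\{1,\ldots,m\}$ such that $\mathbf V_j$ is (the restriction to $\Omega$ of) a vector field in $C^1(\mathbb{R}^n;\mathbb{R}^n)$ that has bounded differential and is globally directed. Then there exists a constant $C_P>0$, only depending on $\Omega$ and $\mathcal C$, such that $$\|u\|_{L^p(\Omega)}\le C_P\|\nabla_{\mathcal C}\,u\|_{L^p(\Omega)}\qquad\text{for all }u\in W^{1,p}_{\mathcal C,0}(\Omega).$$
   Context: For a collection $\mathcal C=\{\mathbf V_1,\dots,\mathbf V_m\}$ of Lipschitz vector fields on $\Omega$, define $W^{1,p}_{\mathcal C}(\Omega):=\{v\in L^p(\Omega): \mathbf V_i\cdot\nabla v\in L^p(\Omega)\ \forall i=1,\dots,m\}$, where $\mathbf V_i\cdot\nabla v$ is taken in the sense of distributions ($\langle\mathbf V_i\cdot\nabla v,\varphi\rangle=-\int_\Omega v\,\mathrm{div}(\varphi\mathbf V_i)$ for $\varphi\in\mathcal D(\Omega)=C_c^\infty(\Omega)$), with its natural graph norm, and $\nabla_{\mathcal C}:=[\mathbf V_1\cdot\nabla,\dots,\mathbf V_m\cdot\nabla]^\top$. $W^{1,p}_{\mathcal C,0}(\Omega)$ is the closure of $\mathcal D(\Omega)$ in $W^{1,p}_{\mathcal C}(\Omega)$.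 A vector field $\mathbf V:\mathbb{R}^n\to\mathbb{R}^n$ is globally directed if there exist $w\in\mathbb{R}^n$ with $\|w\|=1$ and $\alpha\in\mathbb{R}$ such that $\mathbf V(x)\cdot w\ge\alpha>0$ for all $x\in\mathbb{R}^n$. *)

(* Defs.v *)
From HB Require Import structures.
From mathcomp Require Import all_boot all_order all_algebra.
From mathcomp Require Import all_classical all_reals all_analysis.

Set Implicit Arguments.
Unset Strict Implicit.
Unset Printing Implicit Defensive.

Import Order.TTheory GRing.Theory Num.Theory.
Import numFieldNormedType.Exports.

Local Open Scope classical_set_scope.
Local Open Scope ring_scope.

(* The sigma-algebra on 'rV[R]_n is the one generated by the coordinates, i.e.
   the product (equivalently, Borel) sigma-algebra of R^n. *)
Definition measure_rV_display : measure_display.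
Proof. exact: default_measure_display. Qed.

Section measurable_rV.
Context {R : realType} (n : nat).

Definition rV_coord (i : 'I_n) (x : 'rV[R]_n) : measurableTypeR R := x 0 i.

Let rV_set0 : g_sigma_preimage rV_coord set0.
Proof. exact: sigma_algebra0. Qed.

Let rV_setC A : g_sigma_preimage rV_coord A -> g_sigma_preimage rV_coord (~` A).
Proof. exact: sigma_algebraC. Qed.

Let rV_bigcup (F : _^nat) : (forall i, g_sigma_preimage rV_coord (F i)) ->
  g_sigma_preimage rV_coord (\bigcup_i (F i)).
Proof. exact: sigma_algebra_bigcup. Qed.

HB.instance Definition _ := @isMeasurable.Build measure_rV_display
  'rV[R]_n (g_sigma_preimage rV_coord) rV_set0 rV_setC rV_bigcup.

End measurable_rV.

Lemma measurable_rV_coord (R : realType) n (i : 'I_n) :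
  measurable_fun [set: 'rV[R]_n] (rV_coord i).
Proof.
move=> _ Y mY; rewrite setTI; apply: sub_sigma_algebra => /=.
rewrite -bigcup_seq/=; exists i => /=; first by rewrite mem_index_enum.
by exists Y => //; rewrite setTI.
Qed.

Lemma measurable_fun_rVP d (T : measurableType d) (R : realType) n
    (f : T -> 'rV[R]_n) :
  (forall i, measurable_fun [set: T] (rV_coord i \o f)) ->
  measurable_fun [set: T] f.
Proof.
move=> mf.
have pS : g_sigma_preimage (fun i => rV_coord i \o f) `<=` measurable.
  apply: smallest_sub; first exact: sigma_algebra_measurable.
  case: n => [|n] in f mf *; first by rewrite big_ord0.
  rewrite -bigcup_mkord_ord; apply: bigcup_sub => i Ii.
  by move=> A [B mB <-]; exact: mf.
rewrite g_sigma_preimage_comp in pS.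
by move=> _ A mA; apply: pS; exists A.
Qed.

Section rV_cons.
Context {R : realType} (n : nat).

Definition rV_cons (x : measurableTypeR R * 'rV[R]_n) : 'rV[R]_n.+1 :=
  row_mx (x.1 : R)%:M x.2.

Definition rV_uncons (z : 'rV[R]_n.+1) : measurableTypeR R * 'rV[R]_n :=
  (z 0 0, @rsubmx R 1 1 n z).

Lemma rV_consK : cancel rV_cons rV_uncons.
Proof.
case=> x y; rewrite /rV_uncons /rV_cons /= row_mxKr; congr pair.
by rewrite mxE; case: splitP => [j _|k /=]; rewrite ?mxE ?ord1.
Qed.

Lemma measurable_rV_cons : measurable_fun setT rV_cons.
Proof.
apply: measurable_fun_rVP => i.
rewrite (_ : _ \o _ = fun z => match fintype.split (i : 'I_(1 + n)) with
    | inl _ => z.1 | inr j => rV_coord j z.2 end); last first.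
  by apply/funext => z /=; rewrite /rV_coord mxE; case: fintype.split => // j; rewrite mxE ord1.
case: (fintype.split _) => [_|j]; first exact: measurable_fst.
exact: measurableT_comp (measurable_rV_coord j) measurable_snd.
Qed.

Lemma measurable_rV_uncons : measurable_fun setT rV_uncons.
Proof.
apply/measurable_fun_pairP; split; first exact: (measurable_rV_coord 0).
apply: measurable_fun_rVP => j.
rewrite (_ : _ \o _ = rV_coord (rshift 1 j : 'I_n.+1)).
  exact: measurable_rV_coord.
by apply/funext => z /=; rewrite /rV_coord mxE.
Qed.

Variable m : {sigma_finite_measure set 'rV[R]_n -> \bar R}.

Definition lebesgue_rV_step : set 'rV[R]_n.+1 -> \bar R :=
  pushforward (lebesgue_measure \x m)%E rV_cons.

Let step0 : lebesgue_rV_step set0 = 0%E.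
Proof. by rewrite /lebesgue_rV_step /pushforward preimage_set0 measure0. Qed.

Let step_ge0 A : (0 <= lebesgue_rV_step A)%E.
Proof. by rewrite /lebesgue_rV_step /pushforward; exact: measure_ge0. Qed.

Let step_sigma_additive : semi_sigma_additive lebesgue_rV_step.
Proof.
move=> F mF tF mUF; rewrite /lebesgue_rV_step /pushforward preimage_bigcup.
apply: measure_semi_sigma_additive.
- by move=> k; rewrite -[X in measurable X]setTI; exact: measurable_rV_cons.
- apply/trivIsetP => /= i j _ _ ij; rewrite -preimage_setI.
  by move/trivIsetP : tF => /(_ _ _ _ _ ij) ->//; rewrite preimage_set0.
- by rewrite -preimage_bigcup -[X in measurable X]setTI; exact: measurable_rV_cons.
Qed.

HB.instance Definition _ := isMeasure.Build _ _ _ lebesgue_rV_step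
  step0 step_ge0 step_sigma_additive.

Let step_sigma_finite : sigma_finite setT lebesgue_rV_step.
Proof.
have /sigma_finiteP[F [TF ndF Foo]] := sigma_finiteT (@lebesgue_measure R).
have /sigma_finiteP[G [TG ndG Goo]] := sigma_finiteT m.
exists (fun k => rV_uncons @^-1` (F k `*` G k)).
  rewrite -preimage_bigcup (_ : \bigcup_k (F k `*` G k) = setT) ?preimage_setT//.
  rewrite -subTset => -[x y] _.
  have [[k _ Fkx] [l _ Gly]] : (\bigcup_k F k) x /\ (\bigcup_k G k) y.
    by rewrite -TF -TG.
  exists (maxn k l) => //; split.
  - by move: x Fkx; exact/subsetPset/ndF/leq_maxl.
  - by move: y Gly; exact/subsetPset/ndG/leq_maxr.
move=> k; have [mF Fk] := Foo k; have [mG Gk] := Goo k.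
have mFG : measurable (F k `*` G k) by exact: measurableX.
split.
  by rewrite -[X in measurable X]setTI; exact: measurable_rV_uncons.
rewrite /lebesgue_rV_step /pushforward -comp_preimage.
rewrite (_ : rV_uncons \o rV_cons = id); last by apply/funext => z; exact: rV_consK.
by rewrite preimage_id product_measure1E// lte_mul_pinfty// ge0_fin_numE.
Qed.

HB.instance Definition _ := Measure_isSigmaFinite.Build _ _ _ lebesgue_rV_step
  step_sigma_finite.

End rV_cons.

Fixpoint lebesgue_rV (R : realType) (n : nat) :
    {sigma_finite_measure set 'rV[R]_n -> \bar R} :=
  if n is k.+1 then lebesgue_rV_step (lebesgue_rV R k)
  else dirac (0 : 'rV[R]_0).

Lemma lebesgue_rV_box (R : realType) n (A : 'I_n -> set (measurableTypeR R)) :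
  (forall i, measurable (A i)) ->
  lebesgue_rV R n [set x : 'rV[R]_n | forall i, A i (x 0 i)] =
  (\prod_(i < n) lebesgue_measure (A i))%E.
Proof.
elim: n A => [|n IH] A mA.
  rewrite big_ord0 /= /dirac/= indicE mem_set//.
  by case.
rewrite big_ord_recl /= -IH//.
rewrite /lebesgue_rV_step /pushforward.
rewrite (_ : _ @^-1` _ = A 0 `*`
  [set x : 'rV[R]_n | forall i, A (lift ord0 i) (x 0 i)]).
  rewrite product_measure1E//.
  rewrite (_ : mkset _ =
    \bigcap_(i in [set: 'I_n]) (rV_coord i @^-1` A (lift ord0 i))).
    apply: fin_bigcap_measurable => // i _.
    by rewrite -[X in measurable X]setTI; exact: measurable_rV_coord.
  by apply/seteqP; split => x /= h i => [_|]; exact: h.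
apply/seteqP; split => [[x y]/= h|[x y]/= [h0 h] i].
  split => [|i]; first by have := h 0; rewrite mxE; case: splitP => // j _; rewrite mxE ord1.
  have := h (lift ord0 i); rewrite mxE; case: splitP => [[[]]//|j /=].
  by rewrite /bump /= add1n => -[/val_inj ->].
rewrite mxE; case: splitP => [j|j].
  by rewrite ord1 => i0; rewrite mxE (_ : i = 0)//; exact: val_inj.
by move=> ij; rewrite (_ : i = lift ord0 j)//; exact: val_inj.
Qed.

Definition dotp {R : realType} {n} (x y : 'rV[R]_n) : R :=
  \sum_i x 0 i * y 0 i.

Definition enorm {R : realType} {n} (x : 'rV[R]_n) : R := Num.sqrt (dotp x x).

Definition partial {R : realType} {n} (k : 'I_n) (f : 'rV[R]_n -> R) :
  'rV[R]_n -> R := 'D_(delta_mx 0 k) f.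

Fixpoint Ck {R : realType} {n} (k : nat) (f : 'rV[R]_n -> R) : Prop :=
  if k is l.+1 then
    continuous f /\ forall i : 'I_n,
      (forall x, derivable f x (delta_mx 0 i)) /\ Ck l (partial i f)
  else continuous f.

Definition smooth {R : realType} {n} (f : 'rV[R]_n -> R) := forall k, Ck k f.

Definition test_fun {R : realType} {n} (Omega : set 'rV[R]_n) :
    set ('rV[R]_n -> R) :=
  [set phi | smooth phi /\
    compact (closure [set x | phi x != 0]) /\
    closure [set x | phi x != 0] `<=` Omega].

(* A Lipschitz field is differentiable almost everywhere, so for such F the
   pointwise divergence below is the usual one up to a null set, on which
   the derivative operator takes a default value. *)
Definition divergence {R : realType} {n} (F : 'rV[R]_n -> 'rV[R]_n) :
  'rV[R]_n -> R := fun x => \sum_k partial k (fun y => F y 0 k) x.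

Section sobolev.
Context {R : realType} {n : nat}.
Implicit Types (Omega : set 'rV[R]_n) (p : R) (V : 'rV[R]_n -> 'rV[R]_n).
Implicit Types (u v g : 'rV[R]_n -> R).

Let mu := lebesgue_rV R n.

Definition Lpnorm Omega p v : \bar R :=
  Lnorm mu p%:E (EFin \o (v \_ Omega)).

Definition Lp Omega p : set ('rV[R]_n -> R) :=
  [set v | measurable_fun Omega v /\ (Lpnorm Omega p v < +oo)%E].

Definition loc_integrable Omega g :=
  measurable_fun Omega g /\
  forall K, compact K -> K `<=` Omega -> mu.-integrable K (EFin \o g).

Definition is_weak_deriv Omega V v g :=
  loc_integrable Omega g /\
  forall phi, test_fun Omega phi ->
    \int[mu]_(x in Omega) (g x * phi x) =
    - \int[mu]_(x in Omega) (v x * divergence (fun y => phi y *: V y) x).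

(* A representative of the distribution V . grad v when the latter is a
   function; it is unique up to a null set. *)
Definition weak_deriv Omega V v : 'rV[R]_n -> R :=
  xget (cst 0) [set g | is_weak_deriv Omega V v g].

Context {m : nat}.
Implicit Types (C : 'I_m -> 'rV[R]_n -> 'rV[R]_n).

Definition W1p Omega p C : set ('rV[R]_n -> R) :=
  [set v | Lp Omega p v /\
    forall i, exists2 g, is_weak_deriv Omega (C i) v g & Lp Omega p g].

Definition nablaC Omega C v : 'rV[R]_n -> 'rV[R]_m :=
  fun x => \row_i weak_deriv Omega (C i) v x.

Definition Lpnorm_vec Omega p (G : 'rV[R]_n -> 'rV[R]_m) : \bar R :=
  Lpnorm Omega p (fun x => enorm (G x)).

Definition W1p_norm Omega p C v : \bar R :=
  (Lpnorm Omega p v + Lpnorm_vec Omega p (nablaC Omega C v))%E.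

Definition W1p0 Omega p C : set ('rV[R]_n -> R) :=
  [set u | W1p Omega p C u /\
    forall e : R, 0 < e -> exists2 phi, test_fun Omega phi &
      (W1p_norm Omega p C (u \- phi)%R < e%:E)%E].

End sobolev.

Definition C1_field {R : realType} {n} (V : 'rV[R]_n -> 'rV[R]_n) :=
  forall k : 'I_n, Ck 1 (fun x => V x 0 k).

Definition bounded_differential {R : realType} {n}
    (V : 'rV[R]_n -> 'rV[R]_n) :=
  exists M : R, forall x h, `|'d V x h| <= M * `|h|.

Definition globally_directed {R : realType} {n} (V : 'rV[R]_n -> 'rV[R]_n) :=
  exists (w : 'rV[R]_n) (alpha : R), enorm w = 1 /\ 0 < alpha /\
    forall x, alpha <= dotp (V x) w.

(* Main.v *)
Require Import Defs.
From mathcomp Require Import all_boot all_order all_algebra.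
From mathcomp Require Import all_classical all_reals all_analysis.
From mathcomp Require Import measurable_realfun ring lra.

Set Implicit Arguments.
Unset Strict Implicit.
Unset Printing Implicit Defensive.

Import Order.TTheory GRing.Theory Num.Theory.
Import numFieldNormedType.Exports.
Local Open Scope classical_set_scope.
Local Open Scope ring_scope.

(* For a test function [phi] the Poincare inequality comes from integrating
   [div (G(phi) rho V) = 0], where [G] regularises [|.|^p] and
   [rho(x) = exp (- p lambda <x, w>)] decreases along the directed field [V];
   Young's inequality absorbs the term [rho G'(phi) (V . grad phi)].
   For general [u], the chosen weak derivative of [u - phi] has to be compared
   with those of [u] and [phi]: integration by parts shows that
   [V . grad u - V . grad phi] is a weak derivative of [u - phi], and the
   du Bois-Reymond lemma that weak derivatives agree almost everywhere.
   Minkowski's inequality then carries the estimate over to the closure. *)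

(** * Calculus of [Ck] functions *)

(** The regularisation answers two needs. For [p = 1] the function |t| has no derivative at 0, while
    the divergence theorem is applied to C1 fields; and G(t) = (t^2 + e)^(p/2) - e^(p/2) vanishes at
    0, so the field G(phi) rho V still vanishes outside Omega. The price is an error proportional to
    e^(p/2), which is sent to 0. Let M bound |div V| on Omega and S bound |<x, w>| there. With
    lambda = (1 + M) / alpha the weight contributes at most - p (1 + M), which beats div V and
    leaves - p; Young's inequality gives back only p - 1, so one full copy of |phi|^p survives.
    Removing rho costs the ratio exp(2 p lambda S) of its bounds on Omega, and the p-th root exp(2
    lambda S) is the final constant, free of p. Two obstacles shape the rest. Weak derivatives are
    picked by a choice operator, so identities between them hold only almost everywhere. And the
    given field coincides with its C1 extension on Omega only, so the two must be exchanged under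
    the divergence, which is possible because Omega is open. *)

Section directional_chain_rule.
Context {R : realType} {V : normedModType R}.

(* The library lemmas live on the normed module of a [numFieldType]; at a
   [realType], unifying it with the canonical one takes a minute per rewrite. *)
Lemma derivableR_diffP (g : R -> R) t : derivable g t 1 <-> differentiable g t.
Proof. exact (derivable1_diffP g t). Qed.

Lemma derivable_lineP (g : V -> R) t v : derivable g t v <->
  derivable (fun h : R => g (h *: v + t)) 0 1.
Proof. exact (derivable1P g t v). Qed.

Lemma derive1R_comp (f g : R -> R) x : derivable f x 1 -> derivable g (f x) 1 ->
  derive1 (g \o f) x = derive1 g (f x) * derive1 f x.
Proof. exact (@derive1_comp R f g x). Qed.

Lemma derivableR_comp (f g : R -> R) x : derivable f x 1 -> derivable g (f x) 1 ->
  derivable (g \o f) x 1.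
Proof.
move=> /derivableR_diffP df /derivableR_diffP dg; apply/derivableR_diffP.
exact: differentiable_comp.
Qed.

(** A directional derivative sees [f] only through its restriction to a line, so the one-variable
    chain rule at parameter 0 suffices. *)
Lemma is_derive_comp (f : V -> R) (g : R -> R) x v :
  derivable f x v -> derivable g (f x) 1 ->
  is_derive x v (g \o f) (derive1 g (f x) * 'D_v f x).
Proof.
move=> /derivable_lineP; set F := (fun h : R => f (h *: v + x)) => df dg.
have F0 : F 0 = f x by rewrite /F scale0r add0r.
have dg' : derivable g (F 0) 1 by rewrite F0.
have E (k : V -> R) : 'D_v k x = derive1 (fun h : R => k (h *: v + x)) 0.
  rewrite derive1E /derive; set A := (fun h => _); set B := (fun h => _).
  suff -> : A = B by [].
  by apply/funext => h; rewrite /A /B /= addr0 scale0r add0r [_%:A]mulr1.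
split.
  by apply/derivable_lineP; exact (derivableR_comp df dg').
rewrite E (E f) -F0.
exact (derive1R_comp df dg').
Qed.

End directional_chain_rule.

Section Ck_calculus.
Context {R : realType} {n : nat}.
Implicit Types (f g : 'rV[R]_n -> R) (k : nat).

Lemma Ck_continuous k f : Ck k f -> continuous f.
Proof. by case: k => [//|k []]. Qed.

Lemma CkS k f : Ck k.+1 f -> Ck k f.
Proof.
elim: k f => [f []//|k IH f [cf df]]; split => // i.
by have [df' Cf] := df i; split => //; exact: IH.
Qed.

Lemma Ck_cst k (c : R) : Ck k (cst c : 'rV[R]_n -> R).
Proof.
elim: k c => [c|k IH c]; first exact: cst_continuous.
split; first exact: cst_continuous.
move=> i; split; first by move=> x; exact: derivable_cst.
by rewrite (_ : partial i _ = cst 0)//; apply/funext => x; exact: derive_cst.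
Qed.

Lemma CkD k f g : Ck k f -> Ck k g -> Ck k (f \+ g).
Proof.
have cD f' g' : continuous f' -> continuous g' -> continuous (f' \+ g').
  by move=> cf cg x; exact: continuousD (cf x) (cg x).
elim: k f g => [|k IH] f g; first exact: cD.
move=> [cf df] [cg dg]; split; first exact: cD.
move=> i; have [df' Cf] := df i; have [dg' Cg] := dg i; split.
  by move=> x; exact: derivableD.
rewrite (_ : partial i _ = partial i f \+ partial i g); first exact: IH.
by apply/funext => x; exact: deriveD.
Qed.

Lemma CkM k f g : Ck k f -> Ck k g -> Ck k (f \* g).
Proof.
have cM f' g' : continuous f' -> continuous g' -> continuous (f' \* g').
  by move=> cf cg x; exact: continuousM (cf x) (cg x).
elim: k f g => [|k IH] f g; first exact: cM.
move=> Cf Cg; have := Cf; have := Cg => -[cg dg] [cf df].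
split; first exact: cM.
move=> i; have [df' Cf'] := df i; have [dg' Cg'] := dg i; split.
  by move=> x; exact: derivableM.
rewrite (_ : partial i _ = (f \* partial i g) \+ (g \* partial i f)).
  by apply: CkD; apply: IH => //; exact: CkS.
by apply/funext => x; exact: deriveM.
Qed.

Lemma CkZ k (c : R) f : Ck k f -> Ck k (fun x => c * f x).
Proof. by move=> Cf; apply: (@CkM k (cst c)) => //; exact: Ck_cst. Qed.

Lemma Ck_sum k m (f : 'I_m -> 'rV[R]_n -> R) :
  (forall i, Ck k (f i)) -> Ck k (fun x => \sum_i f i x).
Proof.
elim: m f => [f _|m IH f Cf].
  by under eq_fun do rewrite big_ord0; exact: Ck_cst.
under eq_fun do rewrite big_ord_recl.
by apply: CkD => //; apply: IH => i; exact: Cf.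
Qed.

Lemma Ck_prod k m (f : 'I_m -> 'rV[R]_n -> R) :
  (forall i, Ck k (f i)) -> Ck k (fun x => \prod_i f i x).
Proof.
elim: m f => [f _|m IH f Cf].
  by under eq_fun do rewrite big_ord0; exact: Ck_cst.
under eq_fun do rewrite big_ord_recl.
by apply: CkM => //; apply: IH => i; exact: Cf.
Qed.

Lemma Ck1_partial f i : Ck 1 f -> continuous (partial i f).
Proof. by move=> [_ /(_ i)[]]. Qed.

Lemma Ck1_derivable f i x : Ck 1 f -> derivable f x (delta_mx 0 i).
Proof. by move=> [_ /(_ i)[]]. Qed.

Lemma partialM f g i x : Ck 1 f -> Ck 1 g ->
  partial i (f \* g) x = f x * partial i g x + g x * partial i f x.
Proof. by move=> Cf Cg; apply: deriveM; exact: Ck1_derivable. Qed.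

Lemma partial_comp f (g : R -> R) i x : Ck 1 f ->
  (forall t, derivable g t 1) ->
  partial i (g \o f) x = (derive1 g) (f x) * partial i f x.
Proof.
move=> Cf dg.
by have [_ ] := is_derive_comp (@Ck1_derivable f i x Cf) (dg (f x)).
Qed.

Lemma Ck1_comp f (g : R -> R) : Ck 1 f -> (forall t, derivable g t 1) ->
  continuous (derive1 g) -> Ck 1 (g \o f).
Proof.
move=> Cf dg cg'; have := Cf => -[cf df]; split.
  move=> x; apply: continuous_comp; first exact: cf.
  by apply: differentiable_continuous; exact/derivableR_diffP.
move=> i; split.
  move=> x; have [] := is_derive_comp (@Ck1_derivable f i x Cf) (dg (f x)).
  by [].
rewrite (_ : partial i _ = ((derive1 g) \o f) \* partial i f); last first.
  by apply/funext => x; exact: partial_comp.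
apply: (@CkM 0) => /=; last by have [] := df i.
by move=> x; apply: continuous_comp; [exact: cf|exact: cg'].
Qed.

Lemma continuous_rV_coord i : continuous (fun x : 'rV[R]_n => x 0 i).
Proof. exact: coord_continuous. Qed.

Lemma is_derive_affine_coord (a b : R) i j (x : 'rV[R]_n) :
  is_derive x (delta_mx 0 j : 'rV[R]_n) (fun y : 'rV[R]_n => a * y 0 i + b)
    (a * (i == j)%:R).
Proof.
rewrite /derivable/derive.
have E : (fun h : R => h^-1 *: (((fun y : 'rV[R]_n => a * y 0 i + b) \o shift x)
   (h *: delta_mx 0 j : 'rV[R]_n) - (a * x 0 i + b))) @ 0^' --> a * (i == j)%:R.
  apply: cvg_near_cst; near=> h; rewrite /= !mxE eqxx/=.
  have h0 : h != 0 by near: h; exact: nbhs_dnbhs_neq.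
  by rewrite /GRing.scale/=; field.
by split; [apply/cvg_ex; eexists; exact: E|exact: cvg_lim E].
Unshelve. all: by end_near. Qed.

End Ck_calculus.

(** * Smooth bump functions *)

Section flat_function.
Context {R : realType}.
Implicit Types (t : R) (k : nat).

(* The derivatives of [exp (-1/t)] (extended by 0) are linear combinations of the
   functions [t^-k exp (-1/t)], which all vanish to infinite order at 0. *)
Definition flat k t : R := if 0 < t then t^-1 ^+ k * expR (- t^-1) else 0.

Lemma flat_ge0 k t : 0 <= flat k t.
Proof.
rewrite /flat; case: ifPn => // t0.
by rewrite mulr_ge0 ?expR_ge0// exprn_ge0// invr_ge0 ltW.
Qed.

Lemma flat0_le1 t : flat 0 t <= 1.
Proof.
rewrite /flat; case: ifPn => // t0.
by rewrite expr0 mul1r -expR0 ler_expR oppr_le0 invr_ge0 ltW.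
Qed.

(** Raise y <= exp y, with y = 1/((k+1)t), to the power k+1: this gives ((k+1)t)^-(k+1) <= exp(1/t),
    one power of t more than t^-k uses up. *)
Lemma flat_le k t : 0 <= t -> flat k t <= k.+1%:R ^+ k.+1 * t.
Proof.
move=> t0; rewrite /flat; case: ifPn => [{}t0|_]; last first.
  by rewrite mulr_ge0// exprn_ge0.
have kt0 : 0 < k.+1%:R * t by rewrite mulr_gt0.
have h : (k.+1%:R * t)^-1 ^+ k.+1 <= expR t^-1.
  have -> : t^-1 = k.+1%:R * (k.+1%:R * t)^-1.
    by rewrite invfM mulrA mulfV ?mul1r// pnatr_eq0.
  rewrite expRM_natl lerXn2r// ?nnegrE ?expR_ge0 ?invr_ge0 ?(ltW kt0)//.
  by apply: le_trans (expR_ge1Dx _); rewrite lerDr.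
rewrite expRN.
have -> : k.+1%:R ^+ k.+1 * t = t^-1 ^+ k * ((k.+1%:R * t)^-1 ^+ k.+1)^-1.
  rewrite -exprVn invrK exprMn [t ^+ k.+1]exprSr mulrCA.
  by congr (_ * _); rewrite mulrA -exprMn mulVf ?gt_eqF// expr1n mul1r.
rewrite ler_wpM2l ?exprn_ge0 ?invr_ge0 ?(ltW t0)//.
by rewrite lef_pV2// posrE ?expR_gt0// exprn_gt0// invr_gt0.
Qed.

Lemma is_derive_flat k t :
  is_derive t (1 : R) (flat k) (flat k.+2 t - k%:R * flat k.+1 t).
Proof.
have [t0|t0|<-] := ltgtP 0 t.
- have eqf : {near t, (fun s : R => s^-1 ^+ k * expR (- s^-1)) =1 flat k}.
    near=> s; rewrite /flat ifT//; near: s; exact: lt_nbhsr.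
  apply: near_eq_is_derive eqf _.
  have tV : is_derive t (1 : R) (fun s : R => s^-1) (- t ^- 2 *: (1 : R)).
    by apply: is_deriveV; rewrite gt_eqF.
  have tE : is_derive t (1 : R) (fun s : R => expR (- s^-1))
      (expR (- t^-1) * t ^- 2).
    have tN : is_derive t (1 : R) (fun s : R => - s^-1) (- (- t ^- 2 *: (1 : R))).
      exact: is_deriveN.
    have dN := @ex_derive _ _ _ _ _ _ _ tN.
    have dE : derivable expR (- t^-1) 1 by exact: derivable_expR.
    have [dc vc] := is_derive_comp dN dE.
    split; first exact: dc.
    rewrite [LHS]vc; have [_ ->] := tN.
    by rewrite derive1E derive_val /GRing.scale/=; ring.
  have tX : is_derive t (1 : R) (fun s : R => s^-1 ^+ k)
      (- k%:R * t^-1 ^+ k.+1).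
    have [dV vV] := tV.
    have dX : derivable (fun s : R => s ^+ k) (t^-1) 1 by exact: exprn_derivable.
    have [dc vc] := is_derive_comp dV dX.
    split; first exact: dc.
    rewrite [LHS]vc vV exp_derive1 /GRing.scale/= -exprVn.
    by case: (k) => [|j]; rewrite ?mul0r ?oppr0 ?mul0r//= !exprS; ring.
  apply: is_derive_eq (is_deriveM tX tE) _.
  rewrite /flat t0 /GRing.scale/= -exprVn !exprS; ring.
- have eqf : {near t, cst 0 =1 flat k}.
    near=> s; rewrite /flat ifF//; apply/negbTE; rewrite -leNgt ltW//.
    near: s; exact: lt_nbhsl.
  apply: near_eq_is_derive eqf _.
  have tn : (0 < t) = false by apply/negbTE; rewrite -leNgt ltW.
  by rewrite /flat !tn mulr0 subr0; exact: is_derive_cst.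
- have F0 j : flat j 0 = 0 by rewrite /flat ltxx.
  rewrite !F0 mulr0 subr0.
  have E : (fun h : R => h^-1 *: ((flat k \o shift 0) (h *: (1 : R)) - flat k 0))
      @ 0^' --> 0.
    apply/cvgr0Pnorm_le => e e0; near=> h.
    have h0 : h != 0 by near: h; exact: nbhs_dnbhs_neq.
    (* The constant is the one of [flat_le] for [k.+1], because the difference quotient of [flat k]
       at 0 is [flat k.+1 h] itself. *)
    have hle : `|h| <= e / k.+2%:R ^+ k.+2.
      near: h; apply: (@dnbhs0_le R R).
      by rewrite divr_gt0// exprn_gt0.
    rewrite /= addr0 F0 subr0 [_%:A]mulr1.
    have -> : h^-1 *: flat k h = flat k.+1 h.
      rewrite /flat; case: ifP => _; rewrite ?scaler0//.
      by rewrite /GRing.scale/= mulrA exprS.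
    rewrite ger0_norm ?flat_ge0//.
    have [hp|hn] := leP 0 h.
      apply: le_trans (flat_le _ hp) _.
      by rewrite mulrC -ler_pdivlMr ?exprn_gt0// (le_trans (ler_norm h)).
    by rewrite /flat ifF ?ltW//; apply/negbTE; rewrite -leNgt ltW.
  by split; [apply/cvg_ex; eexists; exact: E|exact: cvg_lim E].
Unshelve. all: by end_near. Qed.

(** The family is closed under differentiation up to linear combinations, so all [k] are treated at
    once in an induction on the order [l]. *)
Lemma Ck_flat n l k (a b : R) (i : 'I_n) :
  Ck l (fun x : 'rV[R]_n => flat k (a * x 0 i + b)).
Proof.
have cf j : continuous (fun x : 'rV[R]_n => flat j (a * x 0 i + b)).
  move=> x; apply: (@continuous_comp _ _ _ (fun x : 'rV[R]_n => a * x 0 i + b)).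
    apply: continuousD; last exact: cst_continuous.
    by apply: continuousM; [exact: cst_continuous|exact: continuous_rV_coord].
  apply: differentiable_continuous; apply/derivableR_diffP.
  by have [] := is_derive_flat j (a * x 0 i + b).
elim: l k => [|l IH] k; first exact: cf.
split; first exact: cf.
move=> j.
have d x : is_derive x (delta_mx 0 j : 'rV[R]_n)
    (fun x : 'rV[R]_n => flat k (a * x 0 i + b))
    ((flat k.+2 (a * x 0 i + b) - k%:R * flat k.+1 (a * x 0 i + b)) *
     (a * (i == j)%:R)).
  have [da va] := is_derive_affine_coord a b i j x.
  have [df vf] := is_derive_flat k (a * x 0 i + b).
  have [dc vc] := is_derive_comp da df.
  by split; [exact: dc|rewrite [LHS]vc va derive1E vf].
split; first by move=> x; have [] := d x.
rewrite (_ : partial j _ = (fun x => (a * (i == j)%:R) *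
    (flat k.+2 (a * x 0 i + b) + - k%:R * flat k.+1 (a * x 0 i + b)))).
  apply: CkZ; apply: (@CkD _ _ _ (fun x => flat k.+2 (a * x 0 i + b))) => //.
  exact: CkZ.
by apply/funext => x; have [_] := d x; rewrite mulrC mulNr.
Qed.

(** Dilation drives the exponent -1/((N+1)s) to 0 when s > 0 and keeps the value 0 when s <= 0. The
    limit at s = 0 is 0, which is why open boxes are what the bumps detect. *)
Lemma flat_cvg_step (s : R) :
  flat 0 (N.+1%:R * s) @[N --> \oo] --> ((0 < s)%R%:R : R).
Proof.
have [s0|s0] := ltP 0 s; last first.
  apply: cvg_near_cst; apply: nearW => N; rewrite /flat ifF//.
  by apply/negbTE; rewrite -leNgt mulr_ge0_le0.
rewrite (_ : (fun N => _) = (fun N : nat => expR (- (s^-1 * N.+1%:R^-1)))).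
  rewrite [X in _ --> X](_ : _ = expR (- (s^-1 * 0))); last first.
    by rewrite mulr0 oppr0 expR0.
  apply: continuous_cvg; first exact: continuous_expR.
  apply: cvgN; apply: cvgM; first exact: cvg_cst.
  exact: cvg_harmonic.
apply/funext => N; rewrite /flat ifT ?mulr_gt0// expr0 mul1r invfM.
by rewrite mulrC.
Qed.

End flat_function.

Section boxes.
Context {R : realType} {n : nat}.
Implicit Types (a b x : 'rV[R]_n).

Definition obox a b : set 'rV[R]_n := [set x | forall i, a 0 i < x 0 i < b 0 i].
Definition cbox a b : set 'rV[R]_n := [set x | forall i, a 0 i <= x 0 i <= b 0 i].

Lemma obox_cbox a b : obox a b `<=` cbox a b.
Proof. by move=> x h i; have /andP[/ltW-> /ltW->] := h i. Qed.

Lemma compact_cbox a b : compact (cbox a b).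
Proof.
rewrite (_ : cbox a b = [set x | forall i, `[a 0 i, b 0 i]%classic (x ord0 i)]).
  apply: (@rV_compact R n (fun i => `[a 0 i, b 0 i]%classic)) => i.
  exact: segment_compact.
by apply/seteqP; split => x /= h i; have := h i; rewrite in_itv.
Qed.

Lemma closed_cbox a b : closed (cbox a b).
Proof. apply: compact_closed; [exact: norm_hausdorff|exact: compact_cbox]. Qed.

(** In each coordinate one factor rises from the lower face and one falls towards the upper face.
    These are smooth substitutes, with values in [0, 1], for the indicator of the open box, to which
    they converge pointwise. *)
Definition bump (N : nat) a b x : R := \prod_i
  (flat 0 (N.+1%:R * (x 0 i - a 0 i)) * flat 0 (N.+1%:R * (b 0 i - x 0 i))).

Lemma smooth_bump N a b : smooth (bump N a b).
Proof.
move=> k; apply: Ck_prod => i; apply: CkM.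
  under eq_fun do rewrite mulrBr; exact: Ck_flat.
under eq_fun do rewrite mulrBr addrC -mulNr; exact: Ck_flat.
Qed.

Lemma bump_ge0 N a b x : 0 <= bump N a b x.
Proof. by apply: prodr_ge0 => i _; rewrite mulr_ge0 ?flat_ge0. Qed.

Lemma bump_le1 N a b x : bump N a b x <= 1.
Proof.
rewrite /bump; apply: prodr_ile1 => i _.
by rewrite mulr_ge0 ?flat_ge0//= mulr_ile1 ?flat_ge0 ?flat0_le1.
Qed.

Lemma bump_out N a b x : ~ obox a b x -> bump N a b x = 0.
Proof.
move=> /existsNP[i /negP]; rewrite negb_and -!leNgt => h.
rewrite /bump (bigD1 i)//= /flat; case/orP: h => h.
  by rewrite ifF ?mul0r//; apply/negbTE; rewrite -leNgt mulr_ge0_le0// subr_le0.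
rewrite mulrC [in X in _ * (_ * X)]ifF ?mulr0//.
by apply/negbTE; rewrite -leNgt mulr_ge0_le0// subr_le0.
Qed.

Lemma bump_test_fun N a b (Omega : set 'rV[R]_n) : cbox a b `<=` Omega ->
  test_fun Omega (bump N a b).
Proof.
move=> abO; have sub : closure [set x | bump N a b x != 0] `<=` cbox a b.
  rewrite closureE; apply: smallest_sub; first exact: closed_cbox.
  move=> x /eqP h; apply: obox_cbox; apply: contrapT.
  by move/bump_out => /(_ N).
split; first exact: smooth_bump.
split; last exact: subset_trans abO.
apply: subclosed_compact sub; [exact: closed_closure|exact: compact_cbox].
Qed.

Lemma bump_cvg a b x : (bump N a b x @[N --> \oo] --> (\1_(obox a b) x : R)).
Proof.
rewrite (_ : \1_(obox a b) x =
    \prod_i ((0 < x 0 i - a 0 i)%R%:R * (0 < b 0 i - x 0 i)%R%:R)).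
  have H := @cvg_big R 'I_n *%R 1 predT mul_continuous nat \oo (index_enum _)
    (fun i N => flat 0 (N.+1%:R * (x 0 i - a 0 i)) *
      flat 0 (N.+1%:R * (b 0 i - x 0 i)))
    (fun i => (0 < x 0 i - a 0 i)%R%:R * (0 < b 0 i - x 0 i)%R%:R) _.
  apply: H => i _.
  by apply: cvgM; exact: flat_cvg_step.
rewrite indicE; have [xab|] := boolP (x \in obox a b).
  rewrite big1// => i _; move: xab; rewrite inE => /(_ i)/andP[h1 h2].
  by rewrite !subr_gt0 h1 h2 mulr1.
rewrite notin_setE => /existsNP[i /negP]; rewrite negb_and => h.
rewrite (bigD1 i)//= !subr_gt0.
by case/orP: h => /negbTE->; rewrite ?(mulr0,mul0r).
Qed.

End boxes.

(** * Borel sets and integrability on boxes *)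

Section rV_measurability.
Context {R : realType} {n : nat}.
Implicit Types (a b x : 'rV[R]_n) (A : set 'rV[R]_n).

Lemma measurable_forall_coord (B : 'I_n -> set (measurableTypeR R)) :
  (forall i, measurable (B i)) ->
  measurable [set x : 'rV[R]_n | forall i, B i (x 0 i)].
Proof.
move=> mB; rewrite (_ : mkset _ =
    \bigcap_(i in [set: 'I_n]) (rV_coord i @^-1` B i)).
  apply: fin_bigcap_measurable => // i _.
  by rewrite -[X in measurable X]setTI; exact: measurable_rV_coord.
by apply/seteqP; split => x /= h i => [_|]; exact: h.
Qed.

Lemma measurable_obox a b : measurable (obox a b).
Proof.
rewrite (_ : obox a b = [set x | forall i, `]a 0 i, b 0 i[%classic (x 0 i)]).
  by apply: (@measurable_forall_coord (fun i => `]a 0 i, b 0 i[%classic)) => i;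
    exact: measurable_itv.
by apply/seteqP; split => x /= h i; have := h i; rewrite in_itv.
Qed.

Lemma cboxE a b :
  cbox a b = [set x | forall i, `[a 0 i, b 0 i]%classic (x 0 i)].
Proof. by apply/seteqP; split => x /= h i; have := h i; rewrite in_itv. Qed.

Lemma measurable_cbox a b : measurable (cbox a b).
Proof.
rewrite cboxE.
by apply: (@measurable_forall_coord (fun i => `[a 0 i, b 0 i]%classic)) => i;
  exact: measurable_itv.
Qed.

Lemma lebesgue_rV_cbox_lty a b : (lebesgue_rV R n (cbox a b) < +oo)%E.
Proof.
rewrite cboxE (@lebesgue_rV_box R n (fun i => `[a 0 i, b 0 i]%classic)); last first.
  by move=> i; exact: measurable_itv.
rewrite -ge0_fin_numE; last by apply: prode_ge0 => i _; exact: measure_ge0.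
by apply: prode_fin_num => i _; rewrite lebesgue_measure_itv/=; case: ifP.
Qed.

(** Boxes with rational corners are countably many and fit around every point. [D] asks for the
    closed box to lie in [A], since this makes the bumps on the box test functions of [A]. *)
Lemma open_bigcup_obox A : open A -> exists (D : set nat) (a b : nat -> 'rV[R]_n),
  (forall k, D k -> cbox (a k) (b k) `<=` A) /\
  A = \bigcup_(k in D) obox (a k) (b k).
Proof.
move=> oA.
(* Integers that code no pair of corners get a degenerate pair, which is harmless because [D]
   retains only boxes inside [A]. *)
pose c (k : nat) : 'rV[rat]_n * 'rV[rat]_n :=
  if unpickle k is Some q then q else (0, 0).
pose a k : 'rV[R]_n := map_mx ratr (c k).1.
pose b k : 'rV[R]_n := map_mx ratr (c k).2.
exists [set k | cbox (a k) (b k) `<=` A], a, b; split => //.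
apply/seteqP; split => [x Ax|x [k /= kA xk]]; last exact/kA/obox_cbox.
have /nbhs_ballP[e /= e0 xeA] : nbhs x A by apply: open_nbhs_nbhs; split.
have /fin_all_exists[q hq] (i : 'I_n) : exists q : rat * rat,
    x 0 i - e < ratr q.1 < x 0 i /\ x 0 i < ratr q.2 < x 0 i + e.
  have /rat_in_itvoo[q1] : x 0 i - e < x 0 i by rewrite ltrBlDr ltrDl.
  have /rat_in_itvoo[q2] : x 0 i < x 0 i + e by rewrite ltrDl.
  by rewrite !in_itv/= => h2 h1; exists (q1, q2).
pose k := pickle (\row_i (q i).1, \row_i (q i).2).
have ck : c k = (\row_i (q i).1, \row_i (q i).2) by rewrite /c pickleK.
exists k => /=.
  move=> y yk; apply: xeA; split => // i j; rewrite ord1.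
  have := yk j; rewrite /a /b ck !mxE /= => /andP[h1 h2].
  have [/andP[h3 _] /andP[_ h4]] := hq j.
  rewrite /ball/= ltr_norml; apply/andP; split; lra.
by move=> i; rewrite /a /b ck !mxE /=; have [/andP[_ ->] /andP[->]] := hq i.
Qed.

Lemma open_measurable_rV A : open A -> measurable A.
Proof.
move=> /open_bigcup_obox[D [a [b [_ ->]]]].
by apply: bigcup_measurable => k _; exact: measurable_obox.
Qed.

Lemma compact_measurable_rV A : compact A -> measurable A.
Proof.
move=> /(compact_closed (@norm_hausdorff _ _)) cA.
rewrite -[A]setCK; apply: measurableC; apply: open_measurable_rV.
exact: closed_openC.
Qed.

Lemma continuous_measurable_rV (f : 'rV[R]_n -> R) : continuous f ->
  measurable_fun setT f.
Proof.
move=> /continuousP cf; apply: (measurability _ (RGenOInfty.measurableE R)).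
move=> _ [_ [a ->] <-]; rewrite setTI; apply: open_measurable_rV.
exact/cf/interval_open.
Qed.

(** The norm of row vectors is the maximum of the absolute values of the coordinates, so a ball is
    already a cube. *)
Lemma bounded_sub_cbox A : bounded_set A -> exists r : R, 0 < r /\
  A `<=` cbox (const_mx (- r)) (const_mx r).
Proof.
move=> [M [_ hM]]; exists (`|M| + 1); split; first by rewrite ltr_pwDr.
move=> x Ax i; rewrite !mxE -ler_norml.
have := hM (`|M| + 1) _ _ Ax; rewrite ltr_pwDr ?ler_norm// => /(_ isT).
apply: le_trans; rewrite /Num.norm/= mx_normrE.
exact: (le_bigmax _ (fun ij : 'I_1 * 'I_n => `|x ij.1 ij.2|) (0, i)).
Qed.

Lemma continuous_bounded_cbox (f : 'rV[R]_n -> R) a b : continuous f ->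
  exists M : R, 0 < M /\ forall x, cbox a b x -> `|f x| <= M.
Proof.
move=> cf.
have : compact (f @` cbox a b).
  apply: continuous_compact; last exact: compact_cbox.
  exact: continuous_subspaceT.
move=> /compact_bounded[M [_ hM]]; exists (`|M| + 1); split.
  by rewrite ltr_pwDr.
move=> x abx; apply: (hM (`|M| + 1)); last by exists x.
by rewrite ltr_pwDr ?ler_norm.
Qed.

Lemma integrable_bounded_cbox (f : 'rV[R]_n -> R) a b M :
  measurable_fun setT f -> (forall x, cbox a b x -> `|f x| <= M) ->
  (lebesgue_rV R n).-integrable (cbox a b) (EFin \o f).
Proof.
move=> mf fM; apply: measurable_bounded_integrable.
- exact: measurable_cbox.
- exact: lebesgue_rV_cbox_lty.
- exact: measurable_funTS.
- exists M; split; first exact: num_real.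
  by move=> t Mt x abx; apply: le_trans (fM _ abx) _; exact: ltW.
Qed.

Lemma integrable_continuous_cbox (f : 'rV[R]_n -> R) a b : continuous f ->
  (lebesgue_rV R n).-integrable (cbox a b) (EFin \o f).
Proof.
move=> cf; have [M [_ hM]] := continuous_bounded_cbox a b cf.
by apply: (integrable_bounded_cbox _ hM); exact: continuous_measurable_rV.
Qed.

Lemma integrable_continuous_supp (f : 'rV[R]_n -> R) a b : continuous f ->
  (forall x, ~ cbox a b x -> f x = 0) ->
  (lebesgue_rV R n).-integrable setT (EFin \o f).
Proof.
move=> cf f0; have := integrable_continuous_cbox a b cf.
move/(integrable_mkcond _ (measurable_cbox a b)).
rewrite (_ : (_ \_ _) = EFin \o f)//; apply/funext => x; rewrite patchE.
by case: ifPn => //; rewrite notin_setE => /f0/= ->.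
Qed.

End rV_measurability.

(** * The divergence theorem *)

Section rV_cons_calculus.
Context {R : realType} {n : nat}.
Implicit Types (t : R) (y : 'rV[R]_n).

Lemma rV_cons_ord0 t y : rV_cons (t, y) 0 0 = t.
Proof. by have [] := rV_consK (t, y). Qed.

Lemma rV_cons_lift t y j : rV_cons (t, y) 0 (lift ord0 j) = y 0 j.
Proof.
have [_ h] := rV_consK (t, y).
rewrite -[in RHS]h [RHS]mxE; apply: f_equal; exact: val_inj.
Qed.

Lemma rV_consP t y (z : 'rV[R]_n.+1) : z 0 0 = t ->
  (forall j, z 0 (lift ord0 j) = y 0 j) -> z = rV_cons (t, y).
Proof.
move=> z0 zl; apply/rowP => i; have [j ->|->] := unliftP ord0 i.
  by rewrite rV_cons_lift.
by rewrite rV_cons_ord0.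
Qed.

Lemma rV_cons_shift0 h t y :
  rV_cons (h + t, y) = h *: delta_mx 0 0 + rV_cons (t, y).
Proof.
apply/esym/rV_consP => [|j].
  by rewrite !mxE/= mulr1 -{2}(rV_cons_ord0 t y) [in RHS]mxE.
have := rV_cons_lift t y j; rewrite !mxE => ->.
by rewrite andbF mulr0 add0r.
Qed.

Lemma rV_cons_shift_lift h t y j :
  rV_cons (t, h *: delta_mx 0 j + y) =
  h *: delta_mx 0 (lift ord0 j) + rV_cons (t, y).
Proof.
apply/esym/rV_consP => [|k].
  by have := rV_cons_ord0 t y; rewrite !mxE => ->; rewrite mulr0 add0r.
have := rV_cons_lift t y k; rewrite !mxE => ->.
by rewrite eqxx (inj_eq lift_inj).
Qed.

Lemma continuous_rVP (T : topologicalType) (f : T -> 'rV[R]_n) :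
  (forall i, continuous (fun x => f x 0 i)) -> continuous f.
Proof.
move=> cf x; apply/cvg_ballP => e e0.
have : \forall y \near x, forall i : 'I_n, ball (f x 0 i) e (f y 0 i).
  by apply: filter_forall => i; have /cvg_ballP := cf i x; exact.
by apply: filterS => y h; split => // i j; rewrite ord1.
Qed.

End rV_cons_calculus.

Section line_restriction.
Context {R : realType} {V W : normedModType R}.

(** The two difference quotients are the same function of [h]. This identifies a partial derivative
    in dimension n+1 with a derivative of a slice. *)
Lemma derive_eq_line (f : V -> R) (g : W -> R) x v z w :
  (forall h : R, f (h *: v + x) = g (h *: w + z)) ->
  (derivable g z w -> derivable f x v) * ('D_v f x = 'D_w g z).
Proof.
move=> fg; rewrite /derivable /derive.
set F := (fun h : R => _); set G := (fun h : R => _).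
suff -> : F = G by split.
apply/funext => h; rewrite /F /G/= fg; congr (_ *: (_ - _)).
by have := fg 0; rewrite !scale0r !add0r.
Qed.

End line_restriction.

Section divergence_theorem.
Context {R : realType}.

(** The measure in dimension n+1 is the image of a product measure, so this is a change of variables
    followed by Fubini. Both orders are recorded because the slice carrying the derivative has to be
    integrated innermost. *)
Lemma integral_rV_cons n (f : 'rV[R]_n.+1 -> R) :
  measurable_fun setT f ->
  (lebesgue_rV R n.+1).-integrable setT (EFin \o f) ->
  (\int[lebesgue_rV R n.+1]_z (f z)%:E =
    \int[lebesgue_measure]_t \int[lebesgue_rV R n]_y (f (rV_cons (t, y)))%:E)%E /\
  (\int[lebesgue_rV R n.+1]_z (f z)%:E =
    \int[lebesgue_rV R n]_y \int[lebesgue_measure]_t (f (rV_cons (t, y)))%:E)%E.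
Proof.
move=> mf intf.
have mEf : measurable_fun setT (EFin \o f) by exact/measurable_EFinP.
have mc := @measurable_rV_cons R n.
have intc : (lebesgue_measure \x lebesgue_rV R n)%E.-integrable setT
    ((EFin \o f) \o @rV_cons R n).
  apply/integrableP; split; first exact: measurableT_comp mEf mc.
  move/integrableP : intf => [_]; apply: le_lt_trans.
  have := @ge0_integral_pushforward _ _ _ _ _ _ mc
    (lebesgue_measure \x lebesgue_rV R n)%E setT (fun z => `|(f z)%:E|)%E
    measurableT.
  rewrite preimage_setT => <- //; first exact: measurableT_comp.
have E := @integral_pushforward _ _ _ _ _ _ mc
  (lebesgue_measure \x lebesgue_rV R n)%E setT (EFin \o f) mEf.
rewrite preimage_setT in E; have {E} := E intc measurableT.
rewrite -/(lebesgue_rV_step (lebesgue_rV R n)) => E.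
split; rewrite [LHS]E.
  by rewrite -integral12_prod_meas1.
by rewrite -integral21_prod_meas1.
Qed.

(** Vanishing outside the open interval includes the endpoints, so the fundamental theorem of
    calculus gives f(b) - f(a) = 0. Off the closed interval [f] is locally zero, hence so is its
    derivative. *)
Lemma integral_derive1_supp (f : R -> R) a b : a < b ->
  (forall t, derivable f t 1) -> continuous (derive1 f) ->
  (forall t, ~~ (a < t < b) -> f t = 0) ->
  (\int[lebesgue_measure]_t (derive1 f t)%:E = 0)%E.
Proof.
move=> ab df cf' f0.
have f'0 t : ~~ (a <= t <= b) -> derive1 f t = 0.
  move=> /negP tab; rewrite derive1E.
  have nt : \forall s \near t, f s = cst 0 s.
    have : open (~` `[a, b]%classic) by apply: closed_openC; exact: itv_closed.
    rewrite openE => /(_ t); rewrite /= in_itv/= => /(_ tab).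
    rewrite /interior; apply: filterS => s; rewrite /= in_itv/= => /negP h.
    rewrite /cst; apply: f0; apply: contra h => /andP[h1 h2].
    by rewrite !ltW.
  by rewrite (near_eq_derive _ nt) derive_cst.
have -> : (\int[lebesgue_measure]_t (derive1 f t)%:E =
    \int[lebesgue_measure]_(t in `[a, b]) (derive1 f t)%:E)%E.
  rewrite [RHS]integral_mkcond; apply: eq_integral => t _; rewrite patchE.
  case: ifPn => //; rewrite notin_setE/= in_itv/= => /negP h.
  by rewrite f'0.
have cf t : {for t, continuous f}.
  by apply: differentiable_continuous; exact/derivableR_diffP.
have cf'w : {within `[a, b], continuous (derive1 f)} by exact: continuous_subspaceT.
have LR : derivable_oo_LRcontinuous f a b.
  split; first by move=> t _; exact: df.
    by apply: cvg_at_right_filter; exact: cf.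
  by apply: cvg_at_left_filter; exact: cf.
rewrite (continuous_FTC2 ab cf'w LR (fun t _ => erefl)).
by rewrite !f0 ?ltxx ?andbF// subee.
Qed.

Lemma partial_supp n (F : 'rV[R]_n -> R) a b i :
  (forall x, ~ cbox a b x -> F x = 0) ->
  forall x, ~ cbox a b x -> partial i F x = 0.
Proof.
move=> F0 x xab; rewrite /partial.
have nx : \forall y \near x, F y = cst 0 y.
  have : open (~` cbox a b) by apply: closed_openC; exact: closed_cbox.
  rewrite openE => /(_ x xab); rewrite /interior; apply: filterS => y yab.
  by rewrite F0.
by rewrite (near_eq_derive _ nx) derive_cst.
Qed.

(** Induction on the dimension. If the first coordinate is not the differentiated one, freezing it
    leaves a slice of the same kind in one dimension less; if it is, the inner integral is
    one-dimensional. *)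
Lemma integral_partial0 n (i : 'I_n) (F : 'rV[R]_n -> R) a b :
  continuous F -> (forall x, derivable F x (delta_mx 0 i)) ->
  continuous (partial i F) -> (forall x, ~ cbox a b x -> F x = 0) ->
  (\int[lebesgue_rV R n]_x (partial i F x)%:E = 0)%E.
Proof.
elim: n i F a b => [[]//|n IH] i F a b cF dF cF' F0.
have F'0 := partial_supp i F0.
have mF' := continuous_measurable_rV cF'.
have [E1 E2] := integral_rV_cons mF' (integrable_continuous_supp cF' F'0).
have cC (t : R) : continuous (fun y : 'rV[R]_n => rV_cons (t, y)).
  apply: continuous_rVP => k; have [j ->|->] := unliftP ord0 k.
    under eq_fun do rewrite rV_cons_lift; exact: continuous_rV_coord.
  by under eq_fun do rewrite rV_cons_ord0; exact: cst_continuous.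
have cC1 (y : 'rV[R]_n) : continuous (fun t : R => rV_cons (t, y)).
  apply: continuous_rVP => k; have [j ->|->] := unliftP ord0 k.
    by under eq_fun do rewrite rV_cons_lift; exact: cst_continuous.
  by under eq_fun do rewrite rV_cons_ord0; move=> ?; exact: cvg_id.
have [j ij|i0] := unliftP ord0 i; subst i.
  rewrite E1; apply: integral0_eq => t _.
  pose G y := F (rV_cons (t, y)).
  have GF y := @derive_eq_line R _ _ G F y (delta_mx 0 j) (rV_cons (t, y))
    (delta_mx 0 (lift ord0 j)) (fun h => congr1 F (rV_cons_shift_lift h t y j)).
  have GF' : (fun y => partial (lift ord0 j) F (rV_cons (t, y))) = partial j G.
    by apply/funext => y; rewrite /partial (GF y).2.
  transitivity (\int[lebesgue_rV R n]_y (partial j G y)%:E)%E.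
    by apply: eq_integral => y _; rewrite -GF'.
  apply: (IH j G (\row_k a 0 (lift ord0 k)) (\row_k b 0 (lift ord0 k))).
  - by move=> y; apply: continuous_comp; [exact: cC|exact: cF].
  - by move=> y; apply: (GF y).1; exact: dF.
  - by rewrite -GF' => y; apply: continuous_comp; [exact: cC|exact: cF'].
  - move=> y yab; apply: F0 => h; apply: yab => k.
    by have := h (lift ord0 k); rewrite rV_cons_lift !mxE.
rewrite E2; apply: integral0_eq => y _.
pose G (t : R) := F (rV_cons (t, y)).
have shiftE (h t : R) : G (h *: 1 + t) = F (h *: delta_mx 0 0 + rV_cons (t, y)).
  by rewrite /G -rV_cons_shift0 [_%:A]mulr1.
have GF t := @derive_eq_line R _ _ G F t 1 (rV_cons (t, y))
  (delta_mx 0 0) (fun h => shiftE h t).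
have GF' : (fun t => partial ord0 F (rV_cons (t, y))) = derive1 G.
  by apply/funext => t; rewrite derive1E (GF t).2.
transitivity (\int[lebesgue_measure]_t (derive1 G t)%:E)%E.
  by apply: eq_integral => t _; rewrite -GF'.
(* Nothing orders [a 0 0] and [b 0 0], and [F] is known to vanish only off the closed box. Taking
   the minimum and moving both ends outwards by 1 gives a proper interval at whose endpoints [G] is
   zero. *)
have ge_min_a : Num.min (a 0 0) (b 0 0) <= a 0 0 by rewrite ge_min lexx.
have ge_min_b : Num.min (a 0 0) (b 0 0) <= b 0 0 by rewrite ge_min lexx orbT.
apply: (@integral_derive1_supp G (Num.min (a 0 0) (b 0 0) - 1) (b 0 0 + 1)).
- by have := ge_min_b; lra.
- by move=> t; apply: (GF t).1; exact: dF.
- by rewrite -GF' => t; apply: continuous_comp; [exact: cC1|exact: cF'].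
- move=> t tab; apply: F0 => /(_ ord0); rewrite rV_cons_ord0 => /andP[h1 h2].
  by move/negP: tab; apply; apply/andP; split; lra.
Qed.

End divergence_theorem.

(** * The du Bois-Reymond lemma *)

Section du_bois_reymond.
Context {R : realType} {n : nat}.
Implicit Types (a b x : 'rV[R]_n) (A Omega : set 'rV[R]_n) (g : 'rV[R]_n -> R).
Local Notation mu := (lebesgue_rV R n).
Local Notation oboxes := [set A | exists a b : 'rV[R]_n, A = obox a b].

Lemma oboxI a1 b1 a2 b2 : obox a1 b1 `&` obox a2 b2 =
  obox (\row_i Num.max (a1 0 i) (a2 0 i)) (\row_i Num.min (b1 0 i) (b2 0 i)).
Proof.
apply/seteqP; split => x.
  move=> [h1 h2] i; rewrite !mxE gt_max lt_min.
  by have /andP[-> ->] := h1 i; have /andP[-> ->] := h2 i.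
move=> h; split => i; have := h i; rewrite !mxE gt_max lt_min.
  by move=> /andP[/andP[-> _] /andP[-> _]].
by move=> /andP[/andP[_ ->] /andP[_ ->]].
Qed.

(** This prepares a Dynkin induction over open boxes, which are stable under intersection. A
    coordinate preimage of an open ray is open, hence a countable union of open boxes. *)
Lemma measurable_rV_oboxes : @measurable _ 'rV[R]_n = <<s oboxes >>.
Proof.
apply/seteqP; split.
  apply: smallest_sub; first exact: smallest_sigma_algebra.
  have sub (i : 'I_n) : preimage_set_system setT (@rV_coord R n i) measurable
      `<=` <<s oboxes >>.
    move=> _ [Y mY <-].
    have : measurable_fun [set: g_sigma_algebraType oboxes] (@rV_coord R n i).
      apply: (measurability _ (RGenOInfty.measurableE R)).
      move=> _ [_ [c ->] <-]; rewrite setTI.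
      have : open ((@rV_coord R n i) @^-1` `]c, +oo[%classic).
        have /continuousP := @continuous_rV_coord R n i; apply.
        exact: interval_open.
      move=> /open_bigcup_obox[D [a [b [_ ->]]]].
      apply: bigcup_measurable => k _; apply: sub_sigma_algebra.
      by exists (a k), (b k).
    by move=> /(_ measurableT Y mY).
  elim/big_ind : _ => [//|A B hA hB|i _]; last exact: sub.
  by rewrite subUset.
apply: smallest_sub; first exact: sigma_algebra_measurable.
by move=> _ [a [b ->]]; exact: measurable_obox.
Qed.

Lemma loc_integrable_cbox Omega g a b : loc_integrable Omega g ->
  cbox a b `<=` Omega -> mu.-integrable (cbox a b) (EFin \o g).
Proof. by move=> [_ h] abO; apply: h => //; exact: compact_cbox. Qed.

(** Test against the bumps and let them converge to the indicator of the box; |g| dominates, being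
    integrable on the compact closed box. *)
Lemma integral_obox0 Omega g a b : loc_integrable Omega g ->
  (forall psi, test_fun Omega psi -> \int[mu]_(x in Omega) (g x * psi x) = 0) ->
  cbox a b `<=` Omega -> (\int[mu]_(x in obox a b) (g x)%:E = 0)%E.
Proof.
move=> locg g0 abO.
have intg := loc_integrable_cbox locg abO.
have mab := measurable_cbox a b.
have mg : measurable_fun (cbox a b) g.
  by apply/measurable_EFinP; exact: (measurable_int _ intg).
pose f_ N x := (g x * bump N a b x)%:E.
have mbump N : measurable_fun (cbox a b) (bump N a b).
  apply: measurable_funTS; apply: continuous_measurable_rV.
  exact: (Ck_continuous (smooth_bump N a b 0)).
have fg N x : (`|f_ N x| <= `|(g x)%:E|)%E.
  rewrite lee_fin normrM ler_piMr// ger0_norm ?bump_ge0//; exact: bump_le1.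
have mf_ N : measurable_fun (cbox a b) (f_ N).
  by apply/measurable_EFinP; exact: measurable_funM.
have intf N : mu.-integrable (cbox a b) (f_ N).
  by apply: le_integrable intg => // x _; exact: fg.
have f_0 N : (\int[mu]_(x in cbox a b) f_ N x = 0)%E.
  have := g0 _ (bump_test_fun N abO).
  rewrite /Rintegral => h.
  (* A real-valued integral is [fine] of an extended one, and [fine] also sends infinite values to
     0. Integrability excludes these, so the extended integral is itself 0. *)
  rewrite -(fineK (integrable_fin_num mab (intf N))); congr EFin.
  rewrite -[RHS]h; congr fine; rewrite integral_mkcond [RHS]integral_mkcond.
  apply: eq_integral => x _; rewrite !patchE.
  case: ifPn => [|xab]; first by rewrite inE => /abO xO; rewrite mem_set.
  case: ifPn => // _; rewrite bump_out ?mulr0// => /obox_cbox.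
  by move/mem_set; apply/negP.
have mob := measurable_obox a b.
pose f x := (g x * \1_(obox a b) x)%:E.
have mf : measurable_fun (cbox a b) f.
  by apply/measurable_EFinP; apply: measurable_funM => //; exact: measurable_indic.
have f_f : {ae mu, forall x, cbox a b x -> f_ ^~ x @ \oo --> f x}.
  apply: aeW => x _; apply: cvg_EFin; first exact: nearW.
  by apply: cvgM; [exact: cvg_cst|exact: bump_cvg].
have f_g : {ae mu, forall x N, cbox a b x -> (`|f_ N x| <= `|(g x)%:E|)%E}.
  by apply: aeW => x N _; exact: fg.
have [_ _] := dominated_convergence mab mf_ mf f_f (integrable_abse intg) f_g.
rewrite (_ : [sequence _]_N = cst 0%E); last first.
  by apply/funext => N; exact: f_0.
move=> /(cvg_unique _ (@cvg_cst _ _ _ _ _)) => E.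
rewrite [RHS]E//; clear E.
rewrite [LHS]integral_mkcond [RHS]integral_mkcond; apply: eq_integral => x _.
rewrite !patchE /f; case: ifPn => [xab|xab].
  by rewrite mem_set ?indicE ?xab ?mulr1//; apply: obox_cbox; exact: set_mem.
by rewrite indicE (negbTE xab) mulr0; case: ifP.
Qed.

(** Dynkin's pi-lambda theorem carries the vanishing from boxes to all Borel sets. Intersecting with
    one fixed box keeps [g] integrable, so additivity handles complements and disjoint countable
    unions. *)
Lemma integral_obox_setI0 Omega g a b A : loc_integrable Omega g ->
  (forall psi, test_fun Omega psi -> \int[mu]_(x in Omega) (g x * psi x) = 0) ->
  cbox a b `<=` Omega -> measurable A ->
  (\int[mu]_(x in A `&` obox a b) (g x)%:E = 0)%E.
Proof.
move=> locg g0 abO; rewrite {1}measurable_rV_oboxes.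
have mab := measurable_obox a b.
have intg : mu.-integrable (obox a b) (EFin \o g).
  have := loc_integrable_cbox locg abO.
  by apply: integrableS => //; [exact: measurable_cbox|exact: obox_cbox].
have mg := measurable_int _ intg.
have int0 : (\int[mu]_(x in obox a b) (g x)%:E = 0)%E.
  exact: integral_obox0 abO.
move: A; apply: (@dynkin_induction _ _ oboxes
  (fun A => \int[mu]_(x in A `&` obox a b) (g x)%:E = 0)%E).
- exact: measurable_rV_oboxes.
- move=> _ _ [a1 [b1 ->]] [a2 [b2 ->]]; rewrite oboxI.
  by eexists; eexists; reflexivity.
- by rewrite setTI.
- move=> _ [c [d ->]] /=; rewrite oboxI; apply: (integral_obox0 locg g0).
  apply: subset_trans abO => x h i; have := h i; rewrite !mxE ge_max le_min.
  by move=> /andP[/andP[_ ->] /andP[_ ->]].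
- move=> S mS S0.
  have : (\int[mu]_(x in (S `&` obox a b) `|` (~` S `&` obox a b)) (g x)%:E = 0)%E.
    by rewrite -setIUl setUCr setTI.
  rewrite integral_setU ?S0 ?add0e//.
  + exact: measurableI.
  + by apply: measurableI => //; exact: measurableC.
  + by rewrite -setIUl setUCr setTI.
  + by apply/disj_setPS => x [[Sx _] [nSx _]].
- move=> F mF tF F0; rewrite setI_bigcupl integral_bigcup.
  + by apply: eseries0 => k _ _; exact: F0.
  + apply/trivIsetP => i j _ _ ij; move/trivIsetP : tF => /(_ i j I I ij).
    by rewrite setIACA => ->; rewrite set0I.
  + by move=> k; exact: measurableI.
  + rewrite -setI_bigcupl; apply: integrableS intg => //.
    by apply: measurableI => //; exact: bigcupT_measurable.
Qed.

(** On each box of a countable cover all integrals of [g] over measurable subsets vanish, so [g] is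
    zero almost everywhere there, and countably many null sets have a null union. *)
Lemma du_bois_reymond Omega g : open Omega -> loc_integrable Omega g ->
  (forall psi, test_fun Omega psi -> \int[mu]_(x in Omega) (g x * psi x) = 0) ->
  {ae mu, forall x, Omega x -> g x = 0}.
Proof.
move=> oO locg g0.
have [D [a [b [abO OE]]]] := open_bigcup_obox oO.
have : {ae mu, forall x, forall k : nat, D k -> obox (a k) (b k) x -> g x = 0}.
  apply: ae_foralln => k; have [Dk|nDk] := pselect (D k); last by apply: aeW.
  have intg : mu.-integrable (obox (a k) (b k)) (EFin \o g).
    have := loc_integrable_cbox locg (abO k Dk).
    apply: integrableS; [exact: measurable_cbox|exact: measurable_obox|].
    exact: obox_cbox.
  have : ae_eq mu (obox (a k) (b k)) (EFin \o g) (cst 0%E).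
    apply: integral_ae_eq intg _ _ => //; first exact: measurable_obox.
    move=> E EQ mE; rewrite integral0.
    rewrite -[E](setIidl EQ); exact: (integral_obox_setI0 locg g0 (abO k Dk)).
  by apply: filterS => x h _ /h [].
by apply: filterS => x h; rewrite OE => -[k Dk xk]; exact: h Dk xk.
Qed.

End du_bois_reymond.

(** * A regularised power and the weighted estimate *)

Section regularised_power.
Context {R : realType}.
Implicit Types (p e t X A : R).

(** For e > 0 the base is positive, so the power is differentiable at t = 0 whatever the exponent,
    including the possibly negative one p - 2 of the derivative. *)
Definition regpow p e t : R := (t ^+ 2 + e) `^ (p / 2).

Lemma is_derive_regpow p e t : 0 < e ->
  is_derive t (1 : R) (regpow p e) (p * t * (t ^+ 2 + e) `^ (p / 2 - 1)).
Proof.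
move=> e0.
have te : 0 < t ^+ 2 + e by rewrite ltr_wpDl// sqr_ge0.
have d1 : is_derive t (1 : R) (fun s : R => s ^+ 2 + e) (2 * t).
  have d2 : is_derive t (1 : R) (fun s : R => s ^+ 2) (2 * t).
    split; first exact: exprn_derivable.
    by rewrite -derive1E exp_derive1 expr1.
  have := is_deriveD d2 (is_derive_cst e t (1 : R)); rewrite addr0; exact.
have d3 := is_derive1_powR (p / 2) te.
have [D3 v3] := d3; have [D1 v1] := d1.
have [dc vc] := is_derive_comp D1 D3.
split; first exact: dc.
by rewrite [LHS]vc derive1E v3 v1; field.
Qed.

Lemma derivable_regpow p e t : 0 < e -> derivable (regpow p e) t 1.
Proof. by move=> e0; have [] := is_derive_regpow p t e0. Qed.

Lemma derive1_regpow p e : 0 < e -> derive1 (regpow p e) =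
  (fun t => p * t * regpow (p - 2) e t).
Proof.
move=> e0; apply/funext => t; rewrite derive1E.
have [_ ->] := is_derive_regpow p t e0; rewrite /regpow.
by congr (_ * _ `^ _); field.
Qed.

Lemma continuous_regpow p e : 0 < e -> continuous (regpow p e).
Proof.
move=> e0 t; apply: differentiable_continuous; apply/derivableR_diffP.
exact: derivable_regpow.
Qed.

Lemma continuous_derive1_regpow p e : 0 < e -> continuous (derive1 (regpow p e)).
Proof.
move=> e0; rewrite derive1_regpow// => t.
apply: continuousM; last exact: continuous_regpow.
by apply: continuousM; [exact: cst_continuous|exact: cvg_id].
Qed.

Lemma regpow_ge p e t : 0 <= p -> 0 < e -> `|t| `^ p <= regpow p e t.
Proof.
move=> p0 e0; rewrite /regpow.
have -> : `|t| `^ p = (t ^+ 2) `^ (p / 2).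
  rewrite mulrC powRrM powR12_sqrt ?sqr_ge0// sqrtr_sqr.
  by [].
apply: ge0_ler_powR; rewrite ?nnegrE ?divr_ge0 ?sqr_ge0//.
- by rewrite addr_ge0 ?sqr_ge0// ltW.
- by rewrite lerDl ltW.
Qed.

(** With A = t^2 + e, the bound |t| <= A^(1/2) reduces the left side to p |X| A^((p-1)/2). Young's
    inequality for the exponents p and p/(p-1) splits this product, and the second power is A^(p/2)
    again. That its factor is p - 1 rather than p is what leaves a surplus in the weighted
    estimate. *)
Lemma young_regpow p e t X : 1 <= p -> 0 < e ->
  derive1 (regpow p e) t * X <= (p - 1) * regpow p e t + `|X| `^ p.
Proof.
move=> p1 e0; rewrite derive1_regpow//.
have p0 : 0 < p by exact: lt_le_trans p1.
set A := t ^+ 2 + e; have A0 : 0 < A by rewrite /A ltr_wpDl// sqr_ge0.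
pose b := A `^ ((p - 1) / 2).
have tb : `|t| * regpow (p - 2) e t <= b.
  rewrite /b /regpow -/A.
  have -> : (p - 1) / 2 = 2^-1 + (p - 2) / 2 by field.
  rewrite powRD; last by rewrite (gt_eqF A0) implybT.
  rewrite ler_wpM2r ?powR_ge0//.
  rewrite powR12_sqrt ?(ltW A0)// -sqrtr_sqr ler_wsqrtr//.
  by rewrite /A lerDl ltW.
have h1 : p * t * regpow (p - 2) e t * X <= p * (`|X| * b).
  rewrite -!mulrA ler_wpM2l ?(ltW p0)// mulrA.
  apply: le_trans (ler_norm _) _; rewrite normrM mulrC ler_wpM2l//.
  by rewrite normrM (ger0_norm (powR_ge0 _ _)).
apply: le_trans h1 _.
(* For [p = 1] the conjugate exponent degenerates; there [b = 1] and the bound is already the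
   claim. *)
move: p1; rewrite le_eqVlt => /predU1P[p1|p1].
  by rewrite /b -p1 subrr mul0r powRr0 mul0r add0r mul1r mulr1 powRr1.
have q0 : 0 < p / (p - 1) by rewrite divr_gt0// subr_gt0.
have := @conjugate_powR R `|X| b p (p / (p - 1)) (normr_ge0 _) (powR_ge0 _ _) p0 q0.
have p10 : p - 1 != 0 by rewrite gt_eqF// subr_gt0.
have pn0 : p != 0 by rewrite gt_eqF.
have -> : b `^ (p / (p - 1)) = regpow p e t.
  rewrite /b -powRrM /regpow -/A; congr (_ `^ _); field.
  by rewrite p10.
have E : p^-1 + (p / (p - 1))^-1 = 1.
  by field; rewrite ?p10 ?pn0.
move=> /(_ E) h.
have -> : (p - 1) * regpow p e t + `|X| `^ p =
    p * (`|X| `^ p / p + regpow p e t / (p / (p - 1))).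
  by field; rewrite ?p10 ?pn0.
by rewrite ler_wpM2l ?(ltW p0).
Qed.

End regularised_power.

Section divergence_of_products.
Context {R : realType} {n : nat}.
Implicit Types (f g phi psi : 'rV[R]_n -> R) (V : 'rV[R]_n -> 'rV[R]_n).

Definition dirD V f : 'rV[R]_n -> R := fun x => \sum_k V x 0 k * partial k f x.

Lemma continuous_dirD V f : C1_field V -> Ck 1 f -> continuous (dirD V f).
Proof.
move=> CV Cf; apply: (@Ck_continuous _ _ 0); apply: Ck_sum => k.
apply: (@CkM _ _ 0); first exact: Ck_continuous (CV k).
by have [_ /(_ k)[]] := Cf.
Qed.

Lemma continuous_divergence V : C1_field V -> continuous (divergence V).
Proof.
move=> CV; apply: (@Ck_continuous _ _ 0); apply: Ck_sum => k.
exact: Ck1_partial (CV k).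
Qed.

Lemma C1_fieldZ f V : Ck 1 f -> C1_field V -> C1_field (fun x => f x *: V x).
Proof.
move=> Cf CV k; under eq_fun do rewrite mxE; exact: CkM Cf (CV k).
Qed.

Lemma divergenceZ f V : Ck 1 f -> C1_field V ->
  divergence (fun x => f x *: V x) = (fun x => f x * divergence V x + dirD V f x).
Proof.
move=> Cf CV; apply/funext => x; rewrite /divergence /dirD mulr_sumr -big_split/=.
apply: eq_bigr => k _; under eq_fun do rewrite mxE.
by rewrite (partialM _ _ Cf (CV k)).
Qed.

Lemma dirDM f g V : Ck 1 f -> Ck 1 g ->
  dirD V (f \* g) = (fun x => f x * dirD V g x + g x * dirD V f x).
Proof.
move=> Cf Cg; apply/funext => x; rewrite /dirD !mulr_sumr -big_split/=.
by apply: eq_bigr => k _; rewrite partialM//; ring.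
Qed.

Lemma dirD_comp f (h : R -> R) V : Ck 1 f -> (forall t, derivable h t 1) ->
  dirD V (h \o f) = (fun x => derive1 h (f x) * dirD V f x).
Proof.
move=> Cf dh; apply/funext => x; rewrite /dirD mulr_sumr.
by apply: eq_bigr => k _; rewrite partial_comp//; ring.
Qed.

Lemma integral_divergence0 V a b : C1_field V ->
  (forall x, ~ cbox a b x -> V x = 0) ->
  (\int[lebesgue_rV R n]_x (divergence V x)%:E = 0)%E.
Proof.
move=> CV V0.
have V0k k x : ~ cbox a b x -> V x 0 k = 0 by move=> /V0->; rewrite mxE.
under eq_integral do rewrite /divergence -sumEFin.
rewrite integral_sum//=.
  apply: big1 => k _; apply: (integral_partial0 (a := a) (b := b)) (V0k k).
  - exact: Ck_continuous (CV k).
  - by move=> x; exact: Ck1_derivable (CV k).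
  - exact: Ck1_partial (CV k).
move=> k; apply: (integrable_continuous_supp (a := a) (b := b)).
  exact: Ck1_partial (CV k).
exact: partial_supp (V0k k).
Qed.

End divergence_of_products.

Section linear_weight.
Context {R : realType} {n : nat}.
Implicit Types (w x : 'rV[R]_n) (V : 'rV[R]_n -> 'rV[R]_n).

Lemma dotp_shift h k x w :
  dotp (h *: delta_mx 0 k + x) w = h * w 0 k + dotp x w.
Proof.
rewrite /dotp (eq_bigr (fun i => h * (i == k)%:R * w 0 i + x 0 i * w 0 i)).
  rewrite big_split/=; congr (_ + _); rewrite (bigD1 k)//= eqxx mulr1 big1 ?addr0//.
  by move=> i /negbTE->; rewrite mulr0 mul0r.
by move=> i _; rewrite !mxE eqxx/= mulrDl.
Qed.

Lemma is_derive_dotp w x k :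
  is_derive x (delta_mx 0 k : 'rV[R]_n) (fun y => dotp y w) (w 0 k).
Proof.
have E : (fun h : R => h^-1 *: (((fun y => dotp y w) \o shift x)
   (h *: delta_mx 0 k : 'rV[R]_n) - dotp x w)) @ 0^' --> w 0 k.
  apply: cvg_near_cst; near=> h; rewrite /= dotp_shift addrK.
  have h0 : h != 0 by near: h; exact: nbhs_dnbhs_neq.
  by rewrite /GRing.scale/= mulKf.
by split; [apply/cvg_ex; eexists; exact: E|exact: cvg_lim E].
Unshelve. all: by end_near. Qed.

Lemma Ck1_dotp w : Ck 1 (fun x : 'rV[R]_n => dotp x w).
Proof.
split.
  apply: (@Ck_continuous _ _ 0); apply: Ck_sum => i; apply: (@CkM _ _ 0).
    exact: continuous_rV_coord.
  exact: Ck_cst.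
move=> k; split; first by move=> x; have [] := is_derive_dotp w x k.
rewrite (_ : partial k _ = cst (w 0 k)); first exact: cst_continuous.
by apply/funext => x; have [_] := is_derive_dotp w x k.
Qed.

Lemma dirD_dotp V w x : dirD V (fun y => dotp y w) x = dotp (V x) w.
Proof.
by apply: eq_bigr => k _; congr (_ * _); have [_] := is_derive_dotp w x k.
Qed.

End linear_weight.

Section exponential.
Context {R : realType}.

Lemma is_derive_expRM (c t : R) :
  is_derive t (1 : R) (fun s : R => expR (c * s)) (c * expR (c * t)).
Proof.
have d1 : is_derive t (1 : R) (fun s : R => c * s) c.
  have := is_deriveZ c (is_derive_id t (1 : R)); rewrite [_%:A]mulr1; exact.
have [D1 v1] := d1.
have [dc vc] := is_derive_comp D1 (@derivable_expR R (c * t)).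
by split; [exact: dc|rewrite [LHS]vc v1 derive1E derive_val mulrC].
Qed.

Lemma derivable_expRM (c t : R) : derivable (fun s : R => expR (c * s)) t 1.
Proof. by have [] := is_derive_expRM c t. Qed.

Lemma derive1_expRM (c : R) :
  derive1 (fun s : R => expR (c * s)) = (fun t => c * expR (c * t)).
Proof.
by apply/funext => t; rewrite derive1E; have [_ ->] := is_derive_expRM c t.
Qed.

Lemma continuous_expRM (c : R) : continuous (fun s : R => expR (c * s)).
Proof.
move=> t; apply: differentiable_continuous; apply/derivableR_diffP.
exact: derivable_expRM.
Qed.

Lemma continuous_derive1_expRM (c : R) :
  continuous (derive1 (fun s : R => expR (c * s))).
Proof.
rewrite derive1_expRM.
have h : continuous (fun t : R => c * expR (c * t)).
  by move=> t; apply: cvgM; [exact: cvg_cst|exact: continuous_expRM].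
exact: h.
Qed.

End exponential.

(** * The Poincare inequality for test functions *)

Section poincare_test_functions.
Context {R : realType} {n : nat}.
Variables (Omega : set 'rV[R]_n) (a b : 'rV[R]_n).
Hypotheses (mO : measurable Omega) (Oab : Omega `<=` cbox a b).
Local Notation mu := (lebesgue_rV R n).
Implicit Types (f phi : 'rV[R]_n -> R) (V : 'rV[R]_n -> 'rV[R]_n) (p : R).

Lemma integrable_continuous_sub f : continuous f ->
  mu.-integrable Omega (EFin \o f).
Proof.
move=> /(integrable_continuous_cbox a b); apply: integrableS => //.
exact: measurable_cbox.
Qed.

Lemma integrable_powR_sub f (r : 'rV[R]_n -> R) p : 0 <= p ->
  continuous f -> continuous r ->
  mu.-integrable Omega (EFin \o (fun x => r x * `|f x| `^ p)).
Proof.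
move=> p0 cf cr.
have [Mf [Mf0 hf]] := continuous_bounded_cbox a b cf.
have [Mr [Mr0 hr]] := continuous_bounded_cbox a b cr.
apply: (@integrableS _ _ _ _ (cbox a b)) => //; first exact: measurable_cbox.
apply: (@integrable_bounded_cbox _ _ _ _ _ (Mr * Mf `^ p)).
  apply: measurable_funM; first exact: continuous_measurable_rV.
  apply: (measurableT_comp (measurable_powR p)).
  by apply: measurableT_comp => //; exact: continuous_measurable_rV.
move=> x xab; rewrite normrM (ger0_norm (powR_ge0 _ _)).
apply: ler_pM; [exact: normr_ge0|exact: powR_ge0|exact: hr|].
by apply: ge0_ler_powR => //; rewrite ?nnegrE ?(ltW Mf0)//; exact: hf.
Qed.

Lemma test_fun_Ck k phi : test_fun Omega phi -> Ck k phi.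
Proof. by move=> [h _]; exact: h. Qed.

Lemma test_fun_out phi x : test_fun Omega phi -> ~ Omega x -> phi x = 0.
Proof.
move=> [_ [_ h]] nO; apply: contrapT => /eqP px; apply: nO; apply: h.
exact: subset_closure.
Qed.

Lemma Rintegral_divergence0 V : C1_field V -> (forall x, ~ Omega x -> V x = 0) ->
  (forall x, ~ Omega x -> divergence V x = 0) ->
  \int[mu]_(x in Omega) divergence V x = 0.
Proof.
move=> CV V0 dV0; rewrite /Rintegral.
have V0' x : ~ cbox a b x -> V x = 0 by move=> h; apply: V0 => /Oab.
rewrite -[RHS](congr1 fine (integral_divergence0 CV V0')); congr fine.
rewrite integral_mkcond; apply: eq_integral => x _; rewrite patchE.
by case: ifPn => //; rewrite notin_setE => /dV0 ->.
Qed.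

Section weighted.
Variables (V : 'rV[R]_n -> 'rV[R]_n) (w : 'rV[R]_n) (alpha M : R).
Hypotheses (CV : C1_field V) (alpha0 : 0 < alpha) (M0 : 0 < M)
  (Vw : forall x, alpha <= dotp (V x) w)
  (divM : forall x, Omega x -> `|divergence V x| <= M).

Let lambda := (1 + M) / alpha.

Let rho p x := expR (- (p * lambda) * dotp x w).

Let Ck1_rho p : Ck 1 (rho p).
Proof.
apply: (@Ck1_comp _ _ (fun x => dotp x w)
  (fun s : R => expR (- (p * lambda) * s))).
- exact: Ck1_dotp.
- by move=> t; exact: derivable_expRM.
- exact: continuous_derive1_expRM.
Qed.

Let dirD_rho p x : dirD V (rho p) x = - (p * lambda) * rho p x * dotp (V x) w.
Proof.
rewrite (@dirD_comp _ _ (fun x => dotp x w)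
  (fun s : R => expR (- (p * lambda) * s))).
- by rewrite derive1_expRM dirD_dotp.
- exact: Ck1_dotp.
- by move=> t; exact: derivable_expRM.
Qed.

(* For this [lambda] one has [div (rho V) <= - p rho]. The exponent of [rho] is
   linear in [p], which makes the constant of the Poincare inequality
   independent of [p]. *)
Lemma weighted_poincare p phi : 1 <= p -> test_fun Omega phi ->
  \int[mu]_(x in Omega) (rho p x * `|phi x| `^ p) <=
  \int[mu]_(x in Omega) (rho p x * `|dirD V phi x| `^ p).
Proof.
move=> p1 tphi; have p0 : 0 < p by exact: lt_le_trans p1.
have Cphi := test_fun_Ck 1 tphi.
have crho : continuous (rho p) by exact: Ck_continuous (Ck1_rho p).
have cphi := Ck_continuous Cphi.
have cX : continuous (dirD V phi) by exact: continuous_dirD.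
set I0 := (leLHS); set I1 := (leRHS).
pose I2 := \int[mu]_(x in Omega) rho p x.
have I20 : 0 <= I2 by apply: Rintegral_ge0 => x _; exact: expR_ge0.
(* [d] measures the regularisation error and tends to 0. In the choice of [d] that follows, the 1
   added to [I2] keeps the denominator positive. *)
suff H (d : R) : 0 < d -> I0 <= I1 + p * d * I2.
  apply/ler_addgt0Pr => e e0.
  have := H (e / (p * (I2 + 1))); rewrite divr_gt0 ?mulr_gt0 ?ltr_wpDl//.
  move=> /(_ isT)/le_trans; apply; rewrite lerD2l.
  have -> : p * (e / (p * (I2 + 1))) * I2 = e * (I2 / (I2 + 1)).
    by field; rewrite (gt_eqF p0) gt_eqF// ltr_wpDl.
  by rewrite ler_piMr ?(ltW e0)// ler_pdivrMr ?ltr_wpDl// mul1r lerDl.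
(* [e] is chosen so that [regpow p e 0 = d]; subtracting [d] then makes [G] vanish at 0 and the
   field [H] vanish off Omega. *)
move=> d0; pose e := d `^ (2 / p).
have e0 : 0 < e by exact: powR_gt0.
have ep : e `^ (p / 2) = d.
  rewrite /e -powRrM (_ : 2 / p * (p / 2) = 1) ?powRr1 ?(ltW d0)//.
  by field; rewrite gt_eqF.
pose G t := regpow p e t - d.
have dG t : derivable G t 1.
  by apply: derivableB; [exact: derivable_regpow|exact: derivable_cst].
have G' : derive1 G = derive1 (regpow p e).
  apply/funext => t; rewrite !derive1E /G.
  have := @deriveB _ _ _ (regpow p e) (cst d) t 1.
  move=> -> //; [by rewrite derive_cst subr0|exact: derivable_regpow].
have G0 : G 0 = 0 by rewrite /G /regpow expr0n/= add0r ep subrr.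
have G'0 : derive1 G 0 = 0 by rewrite G' derive1_regpow// mulr0 mul0r.
have CG : Ck 1 (G \o phi).
  have cG' : continuous (derive1 G) by rewrite G'; exact: continuous_derive1_regpow.
  exact (Ck1_comp Cphi dG cG').
have CGr : Ck 1 ((G \o phi) \* rho p) by exact: CkM (Ck1_rho p).
pose H x := ((G \o phi) \* rho p) x *: V x.
have CH : C1_field H by exact: C1_fieldZ.
have divH x : divergence H x = G (phi x) * rho p x *
    (divergence V x - p * lambda * dotp (V x) w) +
    rho p x * (derive1 (regpow p e) (phi x) * dirD V phi x).
  have E1 := divergenceZ CGr CV; have E2 := dirDM V CG (Ck1_rho p).
  rewrite /H E1 E2 dirD_rho (dirD_comp V Cphi dG) G' /=; ring.
have H0 x : ~ Omega x -> H x = 0.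
  by move=> /(test_fun_out tphi) px; rewrite /H /= px G0 mul0r scale0r.
have divH0 x : ~ Omega x -> divergence H x = 0.
  move=> /(test_fun_out tphi) px; rewrite divH px G0 -G' G'0.
  by rewrite !mul0r mulr0 addr0.
have intH := Rintegral_divergence0 CH H0 divH0.
have bound x : Omega x -> divergence H x <=
    (rho p x * `|dirD V phi x| `^ p + p * d * rho p x) - rho p x * `|phi x| `^ p.
  move=> Ox; rewrite divH.
  have r0 : 0 < rho p x by exact: expR_gt0.
  have Gge : `|phi x| `^ p - d <= G (phi x).
    by rewrite lerD2r regpow_ge// ltW.
  (* [regpow] is least at 0, where its value is [d]. The sign is needed to multiply [hdiv] by
     [G (phi x)]. *)
  have Gge0 : 0 <= G (phi x).
    rewrite subr_ge0 -ep /regpow ge0_ler_powR ?nnegrE//.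
    - by rewrite divr_ge0// ltW.
    - exact: ltW.
    - by rewrite addr_ge0 ?sqr_ge0// ltW.
    - by rewrite lerDr sqr_ge0.
  (* Since lambda alpha = 1 + M, the weight contributes at most - p (1 + M), and [1 <= p] makes the
     remainder M - p M nonpositive. *)
  have hdiv : divergence V x - p * lambda * dotp (V x) w <= - p.
    have h1 : divergence V x <= M := le_trans (ler_norm _) (divM Ox).
    have h2 : p * (1 + M) <= p * lambda * dotp (V x) w.
      rewrite -mulrA ler_wpM2l ?(ltW p0)//.
      have -> : 1 + M = lambda * alpha by rewrite /lambda divfK// gt_eqF.
      by rewrite ler_wpM2l// /lambda divr_ge0 ?(ltW alpha0)// addr_ge0// ltW.
    have h3 : M <= p * M by rewrite ler_peMl// ltW.
    by nra.
  have hy := young_regpow (phi x) (dirD V phi x) p1 e0.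
  have h4 : G (phi x) * rho p x * (divergence V x - p * lambda * dotp (V x) w) <=
      rho p x * (- p * G (phi x)).
    have -> : rho p x * (- p * G (phi x)) = G (phi x) * rho p x * - p by ring.
    by rewrite ler_wpM2l// mulr_ge0// ltW.
  have h5 : rho p x * (derive1 (regpow p e) (phi x) * dirD V phi x) <=
      rho p x * ((p - 1) * regpow p e (phi x) + `|dirD V phi x| `^ p).
    by rewrite ler_wpM2l// ltW.
  (* The terms - p G and (p - 1) regpow add up to p d - regpow, and regpow dominates |phi|^p. *)
  apply: le_trans (lerD h4 h5) _.
  have -> : rho p x * `|dirD V phi x| `^ p + p * d * rho p x -
      rho p x * `|phi x| `^ p =
      rho p x * (`|dirD V phi x| `^ p + p * d - `|phi x| `^ p) by ring.
  rewrite -mulrDr ler_wpM2l ?(ltW r0)//.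
  have := regpow_ge (phi x) (ltW p0) e0.
  by rewrite /G; lra.
have i0 : mu.-integrable Omega (EFin \o (fun x => rho p x * `|phi x| `^ p)).
  by apply: integrable_powR_sub => //; exact: ltW.
have i1 : mu.-integrable Omega
    (EFin \o (fun x => rho p x * `|dirD V phi x| `^ p)).
  by apply: integrable_powR_sub => //; exact: ltW.
have i2 : mu.-integrable Omega (EFin \o rho p).
  exact: integrable_continuous_sub.
have i3 : mu.-integrable Omega (EFin \o (fun x => p * d * rho p x)).
  apply: integrable_continuous_sub.
  exact: Ck_continuous (CkZ (p * d) (Ck1_rho p)).
have i4 : mu.-integrable Omega (EFin \o
    (fun x => rho p x * `|dirD V phi x| `^ p + p * d * rho p x)).
  exact: (integrableD mO i1 i3).
have := @le_Rintegral _ _ _ mu Omega (divergence H) _ mO _ _ bound.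
rewrite intH RintegralB// RintegralD// RintegralZl//.
rewrite -/I0 -/I1 -/I2 subr_ge0; apply.
  by apply: integrable_continuous_sub; exact: continuous_divergence.
exact: (integrableB mO i4 i0).
Qed.

Variable S : R.
Hypothesis wS : forall x, Omega x -> `|dotp x w| <= S.

(** On Omega the weight lies between c^-1 and c, so removing it from both sides costs c^2. The
    exponent of this factor is proportional to [p], ready for a p-th root. *)
Lemma poincare_test_fun p phi : 1 <= p -> test_fun Omega phi ->
  \int[mu]_(x in Omega) (`|phi x| `^ p) <=
  expR (p * (2 * lambda * S)) * \int[mu]_(x in Omega) (`|dirD V phi x| `^ p).
Proof.
move=> p1 tphi; have p0 : 0 < p by exact: lt_le_trans p1.
have Cphi := test_fun_Ck 1 tphi.
have crho : continuous (rho p) by exact: Ck_continuous (Ck1_rho p).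
have cphi := Ck_continuous Cphi.
have cX : continuous (dirD V phi) by exact: continuous_dirD.
have l0 : 0 <= lambda by rewrite divr_ge0 ?(ltW alpha0)// addr_ge0// ltW.
have pl0 : 0 <= p * lambda by rewrite mulr_ge0// ltW.
pose c := expR (p * lambda * S).
have rho_le x : Omega x -> rho p x <= c.
  move=> /wS; rewrite ler_norml => /andP[h _].
  by rewrite ler_expR mulNr -mulrN ler_wpM2l// lerNl.
have rho_ge x : Omega x -> c^-1 <= rho p x.
  move=> /wS; rewrite ler_norml => /andP[_ h].
  by rewrite -expRN ler_expR mulNr lerN2 ler_wpM2l.
have i f (k : R) : continuous f ->
    mu.-integrable Omega (EFin \o (fun x => k * `|f x| `^ p)).
  by move=> cf; apply: integrable_powR_sub (ltW p0) cf (@cst_continuous _ _ k).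
have i1 f : continuous f -> mu.-integrable Omega (EFin \o (fun x => `|f x| `^ p)).
  by move=> /(i _ 1); under eq_fun do rewrite mul1r.
have ir f : continuous f ->
    mu.-integrable Omega (EFin \o (fun x => rho p x * `|f x| `^ p)).
  by move=> cf; apply: integrable_powR_sub => //; exact: ltW.
have h := weighted_poincare p1 tphi.
have h1 : c^-1 * \int[mu]_(x in Omega) (`|phi x| `^ p) <=
    \int[mu]_(x in Omega) (rho p x * `|phi x| `^ p).
  rewrite -(RintegralZl c^-1 mO (i1 _ cphi)).
  apply: le_Rintegral => //; [exact: i|exact: ir|].
  by move=> x Ox; rewrite ler_wpM2r ?powR_ge0//; exact: rho_ge.
have h2 : \int[mu]_(x in Omega) (rho p x * `|dirD V phi x| `^ p) <=
    c * \int[mu]_(x in Omega) (`|dirD V phi x| `^ p).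
  rewrite -(RintegralZl c mO (i1 _ cX)).
  apply: le_Rintegral => //; [exact: ir|exact: i|].
  by move=> x Ox; rewrite ler_wpM2r ?powR_ge0//; exact: rho_le.
have := le_trans h1 (le_trans h h2).
rewrite mulrC ler_pdivrMr ?expR_gt0// => /le_trans; apply.
rewrite mulrAC /c -expRD.
by rewrite (_ : p * lambda * S + p * lambda * S = p * (2 * lambda * S))//; ring.
Qed.

End weighted.

End poincare_test_functions.

(** * Lebesgue norms and weak derivatives *)

Section Lpnorm_lemmas.
Context {R : realType} {n : nat}.
Variable Omega : set 'rV[R]_n.
Hypothesis mO : measurable Omega.
Local Notation mu := (lebesgue_rV R n).
Implicit Types (u v : 'rV[R]_n -> R) (p : R).

Lemma LpnormE p v : 0 < p ->
  Lpnorm Omega p v = ((\int[mu]_(x in Omega) (`|v x| `^ p)%:E) `^ p^-1)%E.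
Proof.
move=> p0; rewrite /Lpnorm unlock; apply: (congr1 (fun z => z `^ p^-1)%E).
rewrite [RHS]integral_mkcond; apply: eq_integral => x _.
rewrite /= !patchE; case: ifPn => // _.
by rewrite normr0 powR0// gt_eqF.
Qed.

Lemma Lpnorm_ge0 p v : (0 <= Lpnorm Omega p v)%E.
Proof. exact: Lnorm_ge0. Qed.

Lemma measurable_powR_norm p v : measurable_fun Omega v ->
  measurable_fun Omega (fun x => `|v x| `^ p).
Proof.
move=> mv; apply: (measurableT_comp (measurable_powR p)).
exact: measurableT_comp.
Qed.

Lemma le_Lpnorm p u v : 0 < p -> measurable_fun Omega u -> measurable_fun Omega v ->
  (forall x, Omega x -> `|u x| <= `|v x|) ->
  (Lpnorm Omega p u <= Lpnorm Omega p v)%E.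
Proof.
move=> p0 mf mg uv; rewrite (LpnormE u p0) (LpnormE v p0).
apply: gt0_ler_poweR.
- by rewrite invr_ge0 ltW.
- rewrite in_itv/= leey andbT; apply: integral_ge0 => x _.
  by rewrite lee_fin powR_ge0.
- rewrite in_itv/= leey andbT; apply: integral_ge0 => x _.
  by rewrite lee_fin powR_ge0.
- apply: ge0_le_integral => //.
  + by apply/measurable_EFinP; exact: measurable_powR_norm.
  + by apply/measurable_EFinP; exact: measurable_powR_norm.
  + move=> x Ox; rewrite lee_fin ge0_ler_powR ?nnegrE ?(ltW p0)//.
    exact: uv.
Qed.

Lemma ae_eq_Lpnorm p u v : 0 < p -> measurable_fun Omega u ->
  measurable_fun Omega v -> {ae mu, forall x, Omega x -> u x = v x} ->
  Lpnorm Omega p u = Lpnorm Omega p v.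
Proof.
move=> p0 mf mg uv; rewrite (LpnormE u p0) (LpnormE v p0).
apply: (congr1 (fun z => z `^ p^-1)%E).
apply: ae_eq_integral => //.
- by apply/measurable_EFinP; exact: measurable_powR_norm.
- by apply/measurable_EFinP; exact: measurable_powR_norm.
- by apply: filterS uv => x h Ox; rewrite h.
Qed.

Lemma LpnormD p u v : 1 <= p -> measurable_fun Omega u -> measurable_fun Omega v ->
  (Lpnorm Omega p (u \+ v)%R <= Lpnorm Omega p u + Lpnorm Omega p v)%E.
Proof.
move=> p1 mf mg.
have := @minkowski_EFin _ _ _ mu (u \_ Omega) (v \_ Omega) p
  ((measurable_restrictT u mO).1 mf) ((measurable_restrictT v mO).1 mg) p1.
rewrite (_ : (_ \+ _)%R = (u \+ v)%R \_ Omega)//.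
by apply/funext => x; rewrite /= !patchE; case: ifP => //; rewrite addr0.
Qed.

Lemma LpnormN p v : Lpnorm Omega p (\- v)%R = Lpnorm Omega p v.
Proof.
rewrite /Lpnorm unlock; apply: (congr1 (fun z => z `^ p^-1)%E).
apply: eq_integral => x _.
by rewrite /= !patchE; case: ifP => //; rewrite normrN.
Qed.

(** The bound |v| <= 1 + |v|^p suffices on a set of finite measure, a finiteness expressed here by
    the integrability of the constant 1. *)
Lemma Lp_integrable p v : 1 <= p -> mu.-integrable Omega (EFin \o cst 1) ->
  Lp Omega p v -> mu.-integrable Omega (EFin \o v).
Proof.
move=> p1 i1 [mv]; have p0 : 0 < p by exact: lt_le_trans p1.
rewrite LpnormE// => /(lty_poweRy (invr_neq0 (lt0r_neq0 p0))) h.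
have ip : mu.-integrable Omega (EFin \o (fun x => `|v x| `^ p)).
  apply/integrableP; split.
    by apply/measurable_EFinP; exact: measurable_powR_norm.
  apply: le_lt_trans h; rewrite le_eqVlt; apply/orP; left; apply/eqP.
  by apply: eq_integral => x _; rewrite /= ger0_norm// powR_ge0.
have := integrableD mO i1 ip; apply: le_integrable => //.
  exact/measurable_EFinP.
move=> x _; rewrite lee_fin /= [leRHS]ger0_norm ?addr_ge0 ?powR_ge0//.
have [v1|v1] := leP `|v x| 1.
  by apply: le_trans v1 _; rewrite lerDl powR_ge0.
apply: le_trans (_ : `|v x| `^ p <= _); last by rewrite lerDr.
by rewrite le1r_powR// ltW.
Qed.

End Lpnorm_lemmas.

Section weak_derivative.
Context {R : realType} {n : nat}.
Variables (Omega : set 'rV[R]_n) (a b : 'rV[R]_n).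
Hypotheses (oO : open Omega) (Oab : Omega `<=` cbox a b).
Local Notation mu := (lebesgue_rV R n).
Implicit Types (u v g phi psi : 'rV[R]_n -> R) (V W : 'rV[R]_n -> 'rV[R]_n).

Let mO : measurable Omega := open_measurable_rV oO.

Lemma measurable_continuous_sub phi : continuous phi -> measurable_fun Omega phi.
Proof. by move=> cphi; apply: measurable_funTS; exact: continuous_measurable_rV. Qed.

Lemma loc_integrableB g h : loc_integrable Omega g -> loc_integrable Omega h ->
  loc_integrable Omega (fun x => g x - h x).
Proof.
move=> [mg ig] [mh ih]; split; first exact: measurable_funB.
move=> K cK KO; have mK := compact_measurable_rV cK.
exact: (integrableB mK (ig K cK KO) (ih K cK KO)).
Qed.

Lemma continuous_loc_integrable phi : continuous phi -> loc_integrable Omega phi.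
Proof.
move=> cphi; split; first exact: measurable_continuous_sub.
move=> K cK KO; have := integrable_continuous_cbox a b cphi.
apply: integrableS; [exact: measurable_cbox|exact: compact_measurable_rV|].
exact: subset_trans KO Oab.
Qed.

Lemma integrable_mul_bounded (A : set 'rV[R]_n) g f : measurable A ->
  A `<=` cbox a b -> mu.-integrable A (EFin \o g) -> continuous f ->
  mu.-integrable A (EFin \o (fun x => g x * f x)).
Proof.
move=> mA Aab ig cf.
have [M [M0 hM]] := continuous_bounded_cbox a b cf.
have mg : measurable_fun A g by apply/measurable_EFinP; exact: measurable_int ig.
have := integrableZl mA M ig; apply: le_integrable => //.
  apply/measurable_EFinP; apply: measurable_funM => //.
  by apply: measurable_funTS; exact: continuous_measurable_rV.
move=> x /Aab xab; rewrite lee_fin !normrM mulrC ler_wpM2r//.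
by rewrite (gtr0_norm M0); exact: hM.
Qed.

(** [g] is integrable on compact subsets only, but the product lives on the compact support of
    [psi], where [psi] is bounded. *)
Lemma integrable_mul_test g psi : loc_integrable Omega g ->
  test_fun Omega psi -> mu.-integrable Omega (EFin \o (fun x => g x * psi x)).
Proof.
move=> [mg ig] tpsi; have [_ [cK KO]] := tpsi.
set K := closure _ in cK KO.
have mK := compact_measurable_rV cK.
have := integrable_mul_bounded mK (subset_trans KO Oab) (ig K cK KO)
  (Ck_continuous (test_fun_Ck 0 tpsi)).
move=> /(integrable_mkcond _ mK) h; apply/(integrable_mkcond _ mO).
rewrite [X in _.-integrable _ X](_ : _ =
  (EFin \o (fun x => g x * psi x)) \_ K)//.
apply/funext => x; rewrite !patchE.
have [xK|xK] := boolP (x \in K).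
  by rewrite mem_set//; apply: KO; exact: set_mem.
have px : psi x = 0.
  apply: contrapT => /eqP px; move/negP: xK; apply; apply: mem_set.
  exact: subset_closure.
by rewrite /= px mulr0; case: ifP.
Qed.

(** The field phi (psi V) is C1 and vanishes off Omega, so its divergence integrates to zero;
    bracketed this way, the product rule yields exactly the two integrands. *)
Lemma Rintegral_by_parts V phi psi : C1_field V ->
  test_fun Omega phi -> test_fun Omega psi ->
  \int[mu]_(x in Omega) (dirD V phi x * psi x) =
  - \int[mu]_(x in Omega) (phi x * divergence (fun y => psi y *: V y) x).
Proof.
move=> CV tphi tpsi.
have Cphi := test_fun_Ck 1 tphi; have Cpsi := test_fun_Ck 1 tpsi.
have CW : C1_field (fun y => psi y *: V y) by exact: C1_fieldZ.
have E x : divergence (fun y => phi y *: (psi y *: V y)) x =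
    phi x * divergence (fun y => psi y *: V y) x + dirD V phi x * psi x.
  rewrite divergenceZ//; congr (_ + _); rewrite /dirD mulr_suml.
  by apply: eq_bigr => k _; rewrite mxE; ring.
have H0 x : ~ Omega x -> phi x *: (psi x *: V x) = 0.
  by move=> /(test_fun_out tphi) ->; rewrite scale0r.
have divH0 x : ~ Omega x -> divergence (fun y => phi y *: (psi y *: V y)) x = 0.
  move=> nO; rewrite E (test_fun_out tphi nO) (test_fun_out tpsi nO).
  by rewrite mul0r mulr0 addr0.
have CH := C1_fieldZ Cphi CW.
have := Rintegral_divergence0 Oab CH H0 divH0.
under eq_Rintegral do rewrite E.
rewrite RintegralD//.
- by move=> /eqP; rewrite addrC addr_eq0 => /eqP.
- apply: (integrable_continuous_sub mO Oab).
  apply: (@Ck_continuous _ _ 0); apply: (@CkM _ _ 0).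
    exact: Ck_continuous Cphi.
  exact: continuous_divergence.
- apply: integrable_mul_test => //.
  by apply: continuous_loc_integrable; exact: continuous_dirD.
Qed.

(** In an open set, equality at all points is equality near each point, and derivatives are local.
    This lets a given field be replaced by its C1 extension. *)
Lemma eq_divergence_open V W x : (forall y, Omega y -> V y = W y) -> Omega x ->
  divergence V x = divergence W x.
Proof.
move=> VW Ox; apply: eq_bigr => k _; apply: near_eq_derive.
have : nbhs x Omega by apply: open_nbhs_nbhs; split.
by apply: filterS => y /VW ->.
Qed.

Lemma ae_unique_weak_deriv V v g h : is_weak_deriv Omega V v g ->
  is_weak_deriv Omega V v h -> {ae mu, forall x, Omega x -> g x = h x}.
Proof.
move=> [lg hg] [lh hh].
have : {ae mu, forall x, Omega x -> g x - h x = 0}.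
  apply: du_bois_reymond => //; first exact: loc_integrableB.
  move=> psi tpsi; under eq_Rintegral do rewrite mulrBl.
  rewrite RintegralB//; [|exact: integrable_mul_test..].
  by rewrite hg// hh// subrr.
by apply: filterS => x h0 /h0 /eqP; rewrite subr_eq0 => /eqP.
Qed.

(** Two fields occur because the weak derivative refers to the given field [W], while integration by
    parts is carried out for its C1 extension [V]. Integrability of [u] justifies splitting the
    integral of (u - phi) times the divergence. *)
Lemma is_weak_deriv_subr_test V W u g phi : (forall x, Omega x -> W x = V x) ->
  C1_field V -> mu.-integrable Omega (EFin \o u) ->
  is_weak_deriv Omega W u g -> test_fun Omega phi ->
  is_weak_deriv Omega W (u \- phi)%R (fun x => g x - dirD V phi x).
Proof.
move=> WV CV iu [lg hg] tphi.
have Cphi := test_fun_Ck 1 tphi.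
have lX : loc_integrable Omega (dirD V phi).
  by apply: continuous_loc_integrable; exact: continuous_dirD.
split; first exact: loc_integrableB.
move=> psi tpsi; have Cpsi := test_fun_Ck 1 tpsi.
pose D := divergence (fun y => psi y *: V y).
have DE x : Omega x -> divergence (fun y => psi y *: W y) x = D x.
  by apply: eq_divergence_open => y /WV ->.
have cD : continuous D by apply: continuous_divergence; exact: C1_fieldZ.
under eq_Rintegral do rewrite mulrBl.
rewrite RintegralB//; [|exact: integrable_mul_test..].
rewrite hg// (Rintegral_by_parts CV tphi tpsi) -/D opprK.
have -> : \int[mu]_(x in Omega) (u x * divergence (fun y => psi y *: W y) x) =
    \int[mu]_(x in Omega) (u x * D x).
  by apply: eq_Rintegral => x; rewrite inE => /DE ->.
have -> : \int[mu]_(x in Omega)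
      ((u \- phi) x * divergence (fun y => psi y *: W y) x) =
    \int[mu]_(x in Omega) (u x * D x - phi x * D x).
  by apply: eq_Rintegral => x; rewrite inE => /DE ->; rewrite mulrBl.
rewrite RintegralB//.
- by rewrite opprB addrC.
- exact: integrable_mul_bounded.
- apply: integrable_mul_bounded => //.
  by apply: (integrable_continuous_sub mO Oab); exact: Ck_continuous Cphi.
Qed.

Lemma weak_derivP V v g : is_weak_deriv Omega V v g ->
  is_weak_deriv Omega V v (weak_deriv Omega V v).
Proof.
move=> h; apply: (@xgetPex _ _ [set g | is_weak_deriv Omega V v g]).
by exists g.
Qed.

(** If no weak derivative exists, the choice falls back on the constant 0, which is measurable as
    well. *)
Lemma measurable_weak_deriv V v : measurable_fun Omega (weak_deriv Omega V v).
Proof.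
rewrite /weak_deriv; case: xgetP => [g _ [[mg _] _]//|_].
exact: measurable_cst.
Qed.

End weak_derivative.

Section gradient_norm.
Context {R : realType}.

Lemma norm_le_enorm m (G : 'rV[R]_m) (j : 'I_m) : `|G 0 j| <= enorm G.
Proof.
rewrite -sqrtr_sqr ler_wsqrtr// /dotp (bigD1 j)//= expr2 lerDl.
by apply: sumr_ge0 => i _; rewrite -expr2 sqr_ge0.
Qed.

Lemma measurable_enorm_nablaC n m (Omega : set 'rV[R]_n)
    (C : 'I_m -> 'rV[R]_n -> 'rV[R]_n) v :
  measurable_fun Omega (fun x => enorm (nablaC Omega C v x)).
Proof.
apply: (measurableT_comp (continuous_measurable_fun (@sqrt_continuous R))).
apply: measurable_sum => i; under eq_fun do rewrite mxE.
by apply: measurable_funM; exact: measurable_weak_deriv.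
Qed.

Lemma Lpnorm_weak_deriv_le n m (Omega : set 'rV[R]_n)
    (C : 'I_m -> 'rV[R]_n -> 'rV[R]_n) p v j : measurable Omega -> 0 < p ->
  (Lpnorm Omega p (weak_deriv Omega (C j) v) <=
   Lpnorm_vec Omega p (nablaC Omega C v))%E.
Proof.
move=> mO p0; apply: le_Lpnorm => //; first exact: measurable_weak_deriv.
  exact: measurable_enorm_nablaC.
move=> x _; rewrite [leRHS]ger0_norm ?sqrtr_ge0//.
by have := norm_le_enorm (nablaC Omega C v x) j; rewrite mxE.
Qed.

End gradient_norm.

(** * From test functions to their closure *)

Theorem theoremA5 (R : realType) (n m : nat) (Omega : set 'rV[R]_n)
    (C : 'I_m -> 'rV[R]_n -> 'rV[R]_n)
    (openO : open Omega) (bndO : bounded_set Omega)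
    (lipC : forall i : 'I_m, [lipschitz C i x | x in Omega])
    (hdir : exists (j : 'I_m) (V : 'rV[R]_n -> 'rV[R]_n),
      (forall x, Omega x -> C j x = V x) /\ C1_field V /\ bounded_differential V /\
      globally_directed V) :
  exists CP : R, 0 < CP /\
    forall p : R, 1 <= p -> forall u : 'rV[R]_n -> R, W1p0 Omega p C u ->
      (Lpnorm Omega p u <= CP%:E * Lpnorm_vec Omega p (nablaC Omega C u))%E.
Proof.
have [j [V [CjV [CV [_ [w [alpha [_ [alpha0 Vw]]]]]]]]] := hdir.
have [r [_ Or]] := bounded_sub_cbox bndO.
have mO := open_measurable_rV openO.
(* [M] and [S] bound continuous functions on a cube around Omega; they are fixed before [p] and [u],
   so the constant depends on neither. *)
have [M [M0 hM]] := continuous_bounded_cbox (const_mx (- r)) (const_mx r)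
  (continuous_divergence CV).
have [S [_ hS]] := continuous_bounded_cbox (const_mx (- r)) (const_mx r)
  (Ck_continuous (Ck1_dotp w)).
set L := 2 * ((1 + M) / alpha) * S.
exists (expR L); split=> [|p p1 u [[Lu hu] happ]]; first exact: expR_gt0.
have p0 : 0 < p by exact: lt_le_trans p1.
have poincare phi : test_fun Omega phi ->
    (Lpnorm Omega p phi <= (expR L)%:E * Lpnorm Omega p (dirD V phi))%E.
  move=> tphi.
  have cphi := Ck_continuous (test_fun_Ck 0 tphi).
  have cX := continuous_dirD CV (test_fun_Ck 1 tphi).
  have i1 (f : 'rV[R]_n -> R) : continuous f ->
      (lebesgue_rV R n).-integrable Omega (EFin \o (fun x => `|f x| `^ p)).
    move=> cf.
    have := integrable_powR_sub mO Or (ltW p0) cf (@cst_continuous _ _ (1 : R)).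
    by under eq_fun do rewrite mul1r.
  pose I (f : 'rV[R]_n -> R) := \int[lebesgue_rV R n]_(x in Omega) (`|f x| `^ p).
  have IE (f : 'rV[R]_n -> R) : continuous f ->
      (\int[lebesgue_rV R n]_(x in Omega) (`|f x| `^ p)%:E = (I f)%:E)%E.
    by move=> cf; rewrite [RHS](fineK (integrable_fin_num mO (i1 _ cf))).
  have I_ge0 f : 0 <= I f by apply: Rintegral_ge0 => x _; exact: powR_ge0.
  have : I phi <= expR (p * L) * I (dirD V phi).
    exact: (poincare_test_fun mO Or CV alpha0 M0 Vw (fun x h => hM x (Or x h))
      (fun x h => hS x (Or x h)) p1 tphi).
  move=> h; rewrite (LpnormE _ phi p0) (LpnormE _ (dirD V phi) p0) !IE//.
  rewrite !poweR_EFin -EFinM lee_fin.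
  apply: le_trans (ge0_ler_powR _ _ _ h) _; rewrite ?nnegrE ?invr_ge0 ?(ltW p0)//.
    by rewrite mulr_ge0 ?expR_ge0.
  (* The p-th root turns exp(p L) into exp L, the same for every [p]. *)
  rewrite powRM ?expR_ge0// -expRM mulrAC mulfV ?mul1r// gt_eqF//.
have [g0 wg0 _] := hu j.
set g := weak_deriv Omega (C j) u.
have wg : is_weak_deriv Omega (C j) u g by exact: weak_derivP wg0.
have mg : measurable_fun Omega g by exact: measurable_weak_deriv.
have iu : (lebesgue_rV R n).-integrable Omega (EFin \o u).
  apply: (Lp_integrable mO p1) Lu.
  by apply: (integrable_continuous_sub mO Or); exact: cst_continuous.
have [mu_ _] := Lu.
set N := Lpnorm_vec Omega p _.
apply/lee_addgt0Pr => e e0.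
have K0 : 0 < 1 + expR L by rewrite addr_gt0// expR_gt0.
(* The tolerance enters twice: once through the norm of [u - phi], and once through its derivative,
   multiplied by exp L. The two shares add up to [e]. *)
have [phi tphi hphi] := happ (e / (1 + expR L)) (divr_gt0 e0 K0).
set d := e / (1 + expR L) in hphi.
have mphi : measurable_fun Omega phi.
  apply: measurable_continuous_sub.
  exact: Ck_continuous (test_fun_Ck 0 tphi).
have mX : measurable_fun Omega (dirD V phi).
  apply: measurable_continuous_sub.
  exact: continuous_dirD CV (test_fun_Ck 1 tphi).
set h := weak_deriv Omega (C j) (u \- phi)%R.
have mh : measurable_fun Omega h by exact: measurable_weak_deriv.
have wgX := is_weak_deriv_subr_test openO Or CjV CV iu wg tphi.
have wh : is_weak_deriv Omega (C j) (u \- phi)%R h by exact: weak_derivP wgX.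
(* The representatives chosen for [u] and for [u - phi] need not be related pointwise; the identity
   holds off a null set, which the norms do not see. *)
have hX : {ae lebesgue_rV R n, forall x, Omega x -> dirD V phi x = (g \+ \- h)%R x}.
  have := ae_unique_weak_deriv openO Or wh wgX.
  by apply: filterS => x hx Ox /=; rewrite hx// opprB addrC subrK.
have uphi : (Lpnorm Omega p (u \- phi)%R <= d%:E)%E.
  apply: le_trans (ltW hphi); rewrite /W1p_norm leeDl//.
  exact: Lpnorm_ge0.
have hd : (Lpnorm Omega p h <= d%:E)%E.
  apply: le_trans (Lpnorm_weak_deriv_le _ _ _ _ _) _ => //.
  apply: le_trans (ltW hphi); rewrite /W1p_norm leeDr//.
  exact: Lpnorm_ge0.
have gN : (Lpnorm Omega p g <= N)%E by exact: Lpnorm_weak_deriv_le.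
have Xle : (Lpnorm Omega p (dirD V phi) <= N + d%:E)%E.
  have mNh : measurable_fun Omega (\- h)%R by exact: measurableT_comp.
  rewrite (ae_eq_Lpnorm mO p0 mX _ hX); last exact: measurable_funD.
  apply: le_trans (LpnormD mO p1 mg mNh) _.
  by rewrite LpnormN; exact: leeD.
have uE : u = ((u \- phi) \+ phi)%R by apply/funext => x /=; rewrite subrK.
rewrite {1}uE.
apply: le_trans (LpnormD mO p1 (measurable_funB mu_ mphi) mphi) _.
apply: le_trans (leeD uphi (le_trans (poincare _ tphi) _)) _.
  by apply: lee_wpmul2l Xle; rewrite lee_fin expR_ge0.
rewrite muleDr ?fin_num_adde_defl// addeCA -EFinM -EFinD.
rewrite (_ : d + expR L * d = e)// -{1}[d]mul1r -mulrDl /d mulrC divfK// gt_eqF.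
Qed.
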